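(* The piecewise decision rule (PDR) problem $$J^{\mathrm{PDR}}=\inf\ \ \bm c^\top\bm x+\theta+\frac1\delta\ \sup_{\mathbb P\in\mathcal P}\ \sum_{k=1}^{K}\mathbb P(\bm\xi\in\Xi_k)\,\mathbb E_{\mathbb P}[\bm\xi^\top\bm Q_k\bm\xi\mid\bm\xi\in\Xi_k]$$ over $\bm x\in\mathcal X$, $\theta\in\mathbb R$, $\bm Y_k\in\mathbb R^{N_2\times(S+1)}$, $\bm Q_k\in\mathbb R^{(S+1)\times(S+1)}$ ($k\in[K]$), subject to $$\bm{\mathcal T}_\ell(\bm x)^\top\bm\xi\le(\bm{\mathcal W}_\ell\bm\xi)^\top\bm Y_k\bm\xi+\lambda_\ell\,\bm\xi^\top\bm Q_k\bm\xi+\kappa_\ell\theta\qquad\forall\bm\xi\in\Xi_k,\ \forall k\in[K],\ \forall\ell\in[L+2],$$ is equivalent to the following polynomial-size copositive program; that is, $J^{\mathrm{PDR}}$ equals the infimum of $$\bm c^\top\bm x+\theta+\frac1\delta\left(\gamma\omega-\eta-2\hat{\bm p}^\top\bm r+2\omega\,\hat{\bm p}^\top\mathbf e\right)$$ over $\bm x\in\mathcal X$, $\theta,\eta\in\mathbb R$, $\omega\in\mathbb R_+$, $\bm r,\bm s,\bm\alpha\in\mathbb R^K$, and $\bm\pi_k=(\pi^k_1,\dots,\pi^k_{L+2})\in\mathbb R^{L+2}$, $\bm Y_k\in\mathbb R^{N_2\times(S+1)}$, $\bm Q_k\in\mathbb R^{(S+1)\times(S+1)}$, $\bm B_k\in\mathbb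 S^{S+1}$ ($k\in[K]$), subject to, for every $k\in[K]$, $$s_k+\eta\le\omega,\qquad\sqrt{4r_k^2+(s_k+\eta)^2}\le2\omega-s_k-\eta,$$ $$\alpha_k+\mathrm{tr}(\bm Q_k\hat{\bm\Omega}_k)+\mathrm{tr}(\bm B_k\hat{\bm\Omega}_k)+\epsilon_k\|\bm Q_k^\top+\bm B_k\|_F\le s_k,$$ $$\pi^k_\ell+\kappa_\ell\theta\ge0,\qquad\bm\Delta^k_\ell(\bm x,\bm Y_k,\bm Q_k)-\pi^k_\ell\,\mathbf e_{S+1}\mathbf e_{S+1}^\top\in\mathcal C(\mathcal K_k)\qquad\forall\ell\in[L+2],$$ $$\bm B_k+\alpha_k\,\mathbf e_{S+1}\mathbf e_{S+1}^\top\in\mathcal C(\mathcal K_k).$$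
   Context: Notation: $[n]=\{1,\dots,n\}$; $\mathbf e$ is the all-ones vector and $\mathbf e_i$ the $i$-th standard basis vector; $\mathbb S^n$ is the space of symmetric $n\times n$ matrices; $\|\cdot\|_F$ is the Frobenius norm; $\mathbb 1(\cdot)$ is the indicator of an event; $\delta_{\bm\xi}$ (with a vector subscript) is the Dirac measure at $\bm\xi$. For a closed convex cone $\mathcal K\subseteq\mathbb R^n$, the (generalized) copositive cone is $\mathcal C(\mathcal K)=\{\bm X\in\mathbb S^n:\bm v^\top\bm X\bm v\ge0\ \forall\bm v\in\mathcal K\}$. $\mathcal P(A)$ denotes the set of Borel probability measures supported on $A$. Support set: $\mathcal K\subseteq\mathbb R^S\times\mathbb R_+$ is a closed, convex, full-dimensional cone, and $\Xi=\{\bm\xi\in\mathcal K:\mathbf e_{S+1}^\top\bm\xi=1\}$ is nonempty and compact. Partition: given constructor points $\bm\xi'_1,\dots,\bm\xi'_K$ obtained independently of the samples below, let $\mathcal K_k=\{\bm\xi\in\mathcal K:2(\bm\xi'_i-\bm\xi'_k)^\top\bm\xi\le(\bm\xi_i'^\top\bm\xi'_i-\bm\xi_k'^\top\bm\xi'_k)\,\mathbf e_{S+1}^\top\bm\xi\ \ \forall i\in[K],\,i\ne k\}$ and $\Xi_k=\{\bm\xi\in\mathcal K_k:\mathbf e_{S+1}^\top\bm\xi=1\}$, i.e. the Voronoi cell $\{\bm\xi\in\Xi:\|\bm\xi-\bm\xi'_k\|_2\le\|\bm\xi-\bm\xi'_i\|_2\ \forall i\neq k\}$. The sets $\Xi_1,\dots,\Xi_K$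 are regarded as a partition of $\Xi$. Data: samples $\hat{\bm\xi}_1,\dots,\hat{\bm\xi}_N$ of the random vector $\bm\xi$ with support $\Xi$; $\mathcal I_k=\{i\in[N]:\hat{\bm\xi}_i\in\Xi_k\}$; $\hat p_k=\frac1N\sum_{i\in[N]}\mathbb 1(\hat{\bm\xi}_i\in\Xi_k)$; $\hat{\mathbb P}_k=\frac1{|\mathcal I_k|}\sum_{i\in\mathcal I_k}\delta_{\hat{\bm\xi}_i}$; $\hat{\bm\Omega}_k=\frac1{|\mathcal I_k|}\sum_{i\in\mathcal I_k}\hat{\bm\xi}_i\hat{\bm\xi}_i^\top$. Ambiguity set: with robustness parameters $\gamma\ge0$ and $\epsilon_1,\dots,\epsilon_K\ge0$, let $\Delta=\{\bm p\in\mathbb R^K_+:\mathbf e^\top\bm p=1,\ \sum_{k=1}^K(p_k-\hat p_k)^2/p_k\le\gamma\}$, $\mathcal P_k=\{\mathbb P_k\in\mathcal P(\Xi_k):\|\mathbb E_{\mathbb P_k}[\bm\xi\bm\xi^\top]-\mathbb E_{\hat{\mathbb P}_k}[\bm\xi\bm\xi^\top]\|_F\le\epsilon_k\}$, and $\mathcal P=\{\mathbb P\in\mathcal P(\Xi):\mathbb P=\sum_{k\in[K]}p_k\mathbb P_k\text{ with }\bm p\in\Delta\text{ and }\mathbb P_k\in\mathcal P_k\ \forall k\in[K]\}$. Problem data: $\mathcal X\subseteq\mathbb R^{N_1}$, $\bm c\in\mathbb R^{N_1}$, the scalar level $\delta\in(0,1)$, $\bm D,\bm W_1,\dots,\bm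 W_L\in\mathbb R^{N_2\times(S+1)}$, and maps $\bm x\mapsto\bm T_\ell(\bm x)\in\mathbb R^{S+1}$, $\ell\in[L]$, affine in $\bm x$. Set $(\bm{\mathcal T}_\ell(\bm x),\bm{\mathcal W}_\ell,\lambda_\ell,\kappa_\ell)=(\bm T_\ell(\bm x),\bm W_\ell,0,0)$ for $\ell\in[L]$, $=(\bm0,\bm0,1,0)$ for $\ell=L+1$, and $=(\bm0,-\bm D,1,1)$ for $\ell=L+2$. Finally $$\bm\Delta^k_\ell(\bm x,\bm Y_k,\bm Q_k)=\tfrac12\left(\bm{\mathcal W}_\ell^\top\bm Y_k+\bm Y_k^\top\bm{\mathcal W}_\ell+\lambda_\ell\bm Q_k+\lambda_\ell\bm Q_k^\top-\bm{\mathcal T}_\ell(\bm x)\mathbf e_{S+1}^\top-\mathbf e_{S+1}\bm{\mathcal T}_\ell(\bm x)^\top\right).$$ *)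

(* Defs.v *)
From HB Require Import structures.
From mathcomp Require Import all_boot all_order all_algebra.
From mathcomp Require Import all_classical all_reals all_analysis.

Set Implicit Arguments.
Unset Strict Implicit.
Unset Printing Implicit Defensive.

Import Order.TTheory GRing.Theory Num.Theory.
Import numFieldNormedType.Exports.

Local Open Scope classical_set_scope.
Local Open Scope ring_scope.

Section linear_algebra.
Context {R : realType}.

Definition dot n (u v : 'cV[R]_n) : R := (u^T *m v) 0 0.

Definition qform n (A : 'M[R]_n) (v : 'cV[R]_n) : R := (v^T *m A *m v) 0 0.

Definition frobenius m n (A : 'M[R]_(m, n)) : R :=
  Num.sqrt (\sum_i \sum_j A i j ^+ 2).

Definition ones n : 'cV[R]_n := const_mx 1.

Definition e_last n : 'cV[R]_n.+1 := delta_mx ord_max 0.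

Definition copositive n (K : set 'cV[R]_n) : set 'M[R]_n :=
  [set X | X^T = X /\ forall v, K v -> 0 <= qform X v].

Definition is_cone n (K : set 'cV[R]_n) : Prop :=
  forall (t : R) v, 0 <= t -> K v -> K (t *: v).

Definition is_affine m n (f : 'cV[R]_m -> 'cV[R]_n) : Prop :=
  exists (A : 'M[R]_(n, m)) (b : 'cV[R]_n), forall x, f x = A *m x + b.

End linear_algebra.

(* R^(S+1) with its Borel sigma-algebra. *)
Notation borel_cV R S := (g_sigma_algebraType (@open 'cV[R]_S.+1)).

Section support.
Context {R : realType} {S : nat}.

Definition slice (K : set 'cV[R]_S.+1) : set 'cV[R]_S.+1 :=
  [set xi | K xi /\ dot (e_last S) xi = 1].

(* Convexity is the library's [convex_set], which lives on the alias
   [convex_lmodType]. *)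
Definition support_cone (K : set 'cV[R]_S.+1) : Prop :=
  [/\ closed K, convex_set (K : set (convex_lmodType 'cV[R]_S.+1)),
      is_cone K & interior K !=set0] /\
  [/\ forall xi, K xi -> 0 <= xi ord_max 0,
      slice K !=set0 & compact (slice K)].

Definition voronoi_cone m (K : set 'cV[R]_S.+1) (zeta : 'I_m -> 'cV[R]_S.+1)
    (k : 'I_m) : set 'cV[R]_S.+1 :=
  [set xi | K xi /\ forall i, i != k ->
     2 * dot (zeta i - zeta k) xi <=
     (dot (zeta i) (zeta i) - dot (zeta k) (zeta k)) * dot (e_last S) xi].

(* The closed Voronoi cells [slice (voronoi_cone K zeta k)] meet along their
   common faces, so they form a partition only after ties have been allocated.
   [voronoi_partition] says that the pairwise disjoint sets [Xi k] are the
   Voronoi cells with the ties allocated in some (arbitrary) way: they are an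
   honest Borel partition of the support, and each one differs from the closed
   cell only by points that its closure recovers. *)
Definition voronoi_partition m (K : set 'cV[R]_S.+1)
    (zeta : 'I_m -> 'cV[R]_S.+1) (Xi : 'I_m -> set 'cV[R]_S.+1) : Prop :=
  [/\ forall k, measurable (Xi k : set (borel_cV R S)),
      trivIset [set: 'I_m] Xi,
      \bigcup_k Xi k = slice K &
      forall k, closure (Xi k) = slice (voronoi_cone K zeta k)].

(* Meaningful for a set function [mu] that is a measure; entrywise
   E_mu[xi xi^T]. *)
Definition second_moment (mu : set (borel_cV R S) -> \bar R) : 'M[R]_S.+1 :=
  \matrix_(i, j) fine (\int[mu]_xi ((xi i 0 * xi j 0)%:E))%E.

Definition cond_expectation (P : probability (borel_cV R S) R) (A : set (borel_cV R S))
    (f : (borel_cV R S) -> R) : \bar R :=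
  ((\int[P]_(xi in A) (f xi)%:E) * ((fine (P A))^-1)%:E)%E.

End support.

Section data.
Context {R : realType} {S K N : nat}.
Variables (Xi : 'I_K -> set 'cV[R]_S.+1) (xihat : 'I_N -> 'cV[R]_S.+1).

Definition sample_idx (k : 'I_K) : {set 'I_N} :=
  [set i | `[< Xi k (xihat i) >]]%SET.

Definition phat : 'cV[R]_K :=
  \col_k (N%:R^-1 * \sum_(i < N) \1_(Xi k) (xihat i)).

Definition empirical (k : 'I_K) (A : set (borel_cV R S)) : \bar R :=
  ((#|sample_idx k|%:R^-1)%:E *
     \sum_(i in sample_idx k) \d_(xihat i : borel_cV R S) A)%E.

Definition Omegahat (k : 'I_K) : 'M[R]_S.+1 :=
  #|sample_idx k|%:R^-1 *: \sum_(i in sample_idx k) xihat i *m (xihat i)^T.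

(* The convention is a^2/0 = +oo for a <> 0 and 0^2/0 = 0, which division in
   [R] (where x / 0 = 0) would not give. *)
Definition chi2_term (p q : R) : \bar R :=
  if p == 0 then (if q == 0 then 0%E else +oo%E) else ((p - q) ^+ 2 / p)%:E.

Definition weight_set (gamma : R) : set 'cV[R]_K :=
  [set p : 'cV[R]_K | [/\ forall k, 0 <= p k 0, dot (ones K) p = 1 &
     (\sum_(k < K) chi2_term (p k 0)%R (phat k 0)%R <= gamma%:E)%E]].

Definition moment_ball (eps : 'I_K -> R) (k : 'I_K) :
    set (probability (borel_cV R S) R) :=
  [set Pk | Pk (Xi k) = 1%E /\
     frobenius (second_moment Pk - second_moment (empirical k)) <= eps k].

Definition ambiguity_set (supp : set 'cV[R]_S.+1) (gamma : R)
    (eps : 'I_K -> R) : set (probability (borel_cV R S) R) :=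
  [set P | P supp = 1%E /\
     exists (p : 'cV[R]_K) (Pk : 'I_K -> probability (borel_cV R S) R),
       [/\ weight_set gamma p, forall k, moment_ball eps k (Pk k) &
           forall A : set (borel_cV R S), measurable A ->
             P A = (\sum_(k < K) (p k 0)%:E * Pk k A)%E]].

Definition worst_case (supp : set 'cV[R]_S.+1) (gamma : R) (eps : 'I_K -> R)
    (Q : 'I_K -> 'M[R]_S.+1) : \bar R :=
  ereal_sup [set (\sum_(k < K)
      P (Xi k) * cond_expectation P (Xi k) (fun xi => qform (Q k) xi))%E
    | P in ambiguity_set supp gamma eps].

End data.

Section problems.
Context {R : realType} {S N1 N2 L K N : nat}.
Variables (cone : set 'cV[R]_S.+1) (zeta : 'I_K -> 'cV[R]_S.+1).
Variables (Xi : 'I_K -> set 'cV[R]_S.+1) (xihat : 'I_N -> 'cV[R]_S.+1).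
Variables (gamma : R) (eps : 'I_K -> R).
Variables (X : set 'cV[R]_N1) (c : 'cV[R]_N1) (delta : R).
Variables (D : 'M[R]_(N2, S.+1)) (W : 'I_L -> 'M[R]_(N2, S.+1)).
Variable (T : 'I_L -> 'cV[R]_N1 -> 'cV[R]_S.+1).

(* A constraint index l : 'I_(L + 2) is split into inl j (the j-th recourse
   constraint), inr 0 (index L+1) and inr 1 (index L+2). *)
Definition calT (l : 'I_(L + 2)) (x : 'cV[R]_N1) : 'cV[R]_S.+1 :=
  match fintype.split l with inl j => T j x | inr _ => 0 end.

Definition calW (l : 'I_(L + 2)) : 'M[R]_(N2, S.+1) :=
  match fintype.split l with inl j => W j | inr i => if i == 0 then 0 else - D end.

Definition lam (l : 'I_(L + 2)) : R :=
  match fintype.split l with inl _ => 0 | inr _ => 1 end.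

Definition kap (l : 'I_(L + 2)) : R :=
  match fintype.split l with inl _ => 0 | inr i => if i == 0 then 0 else 1 end.

Definition PDR_feasible (x : 'cV[R]_N1) (theta : R)
    (Y : 'I_K -> 'M[R]_(N2, S.+1)) (Q : 'I_K -> 'M[R]_S.+1) : Prop :=
  X x /\ forall k l xi, Xi k xi ->
    dot (calT l x) xi <=
    dot (calW l *m xi) (Y k *m xi) + lam l * qform (Q k) xi + kap l * theta.

Definition PDR_objective (x : 'cV[R]_N1) (theta : R)
    (Q : 'I_K -> 'M[R]_S.+1) : \bar R :=
  ((dot c x + theta)%:E +
   (delta^-1)%:E * worst_case Xi xihat (slice cone) gamma eps Q)%E.

Definition PDR_value : \bar R :=
  ereal_inf [set v | exists x theta Y Q,
    PDR_feasible x theta Y Q /\ v = PDR_objective x theta Q].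

Definition Delta_mx (l : 'I_(L + 2)) (x : 'cV[R]_N1)
    (Yk : 'M[R]_(N2, S.+1)) (Qk : 'M[R]_S.+1) : 'M[R]_S.+1 :=
  2^-1 *: ((calW l)^T *m Yk + Yk^T *m calW l + lam l *: Qk + lam l *: Qk^T
           - calT l x *m (e_last S)^T - e_last S *m (calT l x)^T).

Definition ee_last : 'M[R]_S.+1 := e_last S *m (e_last S)^T.

Definition cop_feasible (x : 'cV[R]_N1) (theta eta omega : R)
    (r s alpha : 'cV[R]_K) (ppi : 'I_K -> 'cV[R]_(L + 2))
    (Y : 'I_K -> 'M[R]_(N2, S.+1)) (Q B : 'I_K -> 'M[R]_S.+1) : Prop :=
  [/\ X x, 0 <= omega, forall k, (B k)^T = B k &
  forall k,
  [/\ s k 0 + eta <= omega /\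
      Num.sqrt (4 * r k 0 ^+ 2 + (s k 0 + eta) ^+ 2)
        <= 2 * omega - s k 0 - eta,
      alpha k 0 + \tr (Q k *m Omegahat Xi xihat k)
        + \tr (B k *m Omegahat Xi xihat k)
        + eps k * frobenius ((Q k)^T + B k) <= s k 0,
      forall l, 0 <= ppi k l 0 + kap l * theta /\
        copositive (voronoi_cone cone zeta k)
          (Delta_mx l x (Y k) (Q k) - ppi k l 0 *: ee_last) &
      copositive (voronoi_cone cone zeta k) (B k + alpha k 0 *: ee_last)]].

Definition cop_objective (x : 'cV[R]_N1) (theta eta omega : R)
    (r : 'cV[R]_K) : R :=
  dot c x + theta + delta^-1 *
    (gamma * omega - eta - 2 * dot (phat Xi xihat) r
     + 2 * omega * dot (phat Xi xihat) (ones K)).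

Definition cop_value : \bar R :=
  ereal_inf [set v | exists x theta eta omega r s alpha ppi Y Q B,
    cop_feasible x theta eta omega r s alpha ppi Y Q B /\
    v = (cop_objective x theta eta omega r)%:E].

End problems.

(* Main.v *)
(* Both problems minimise over the same decisions, so everything reduces to
   dualising the worst-case expectation. Writing P = sum_k p_k P_k, that
   expectation is sum_k p_k <Q_k, M_k> with M_k the second moment of P_k, and the
   supremum splits into an inner one over M_k for each cell and an outer one over
   the weights p.
   Inner problem: the second moments of probabilities on a cell form a bounded
   convex set containing Omegahat_k. Separating the pairs
   (M - N, <Q, M>), with N in the eps_k-ball around Omegahat_k, from (0, V') gives
   a multiplier Z, and B = -(Q + Z). Omegahat_k lies in the ball's interior, so
   the separating hyperplane is not vertical; for eps_k = 0 one takes B = 0.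
   Only symmetric Q_k are used here: symmetrising Q_k changes neither the
   constraints nor the expectation and cannot increase |Q_k^T + B_k|.
   Outer problem: for t = omega - eta the dual optimum over omega is explicit, and
   the weights p_k proportional to phat_k / sqrt (t - s_k) attain it as soon as
   they meet the chi-square constraint with equality, which the intermediate value
   theorem provides. For gamma = 0 the dual value is only approached, as t grows.
   Constraints on a cell extend to the conic hull of its closure by continuity and
   homogeneity; compactness of the slice excludes recession directions. *)

Require Import Defs.
From HB Require Import structures.
From mathcomp Require Import all_boot all_order all_algebra.
From mathcomp Require Import all_classical all_reals all_analysis measurable_realfun.
From mathcomp Require Import ring lra.

Set Implicit Arguments.
Unset Strict Implicit.
Unset Printing Implicit Defensive.

Import Order.TTheory GRing.Theory Num.Theory.
Import numFieldNormedType.Exports.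

Local Open Scope classical_set_scope.
Local Open Scope ring_scope.

(** * Separation of a bounded convex set from the origin *)

Section separation.
Context {R : realType} {V : lmodType R} (ip : V -> V -> R).
Hypothesis ipC : forall u v, ip u v = ip v u.
Hypothesis ipD : forall u v w, ip (u + v) w = ip u w + ip v w.
Hypothesis ipZ : forall a u v, ip (a *: u) v = a * ip u v.

Let ipDr u v w : ip w (u + v) = ip w u + ip w v.
Proof. by rewrite ipC ipD !(ipC _ w). Qed.

Let ipZr a u v : ip v (a *: u) = a * ip v u.
Proof. by rewrite ipC ipZ !(ipC _ v). Qed.

(* Convexity along the segment from a near-minimiser [z] of the norm to [a]
   bounds [ip z a] from below, so no compactness is needed. *)
Lemma bounded_convex_separation (A : set V) (d M : R) :
  0 < d -> A !=set0 ->
  (forall a b t, A a -> A b -> 0 <= t <= 1 -> A ((1 - t) *: a + t *: b)) ->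
  (forall a, A a -> d <= ip a a) ->
  (forall a b, A a -> A b -> ip (b - a) (b - a) <= M) ->
  exists2 z, A z & forall a, A a -> 0 < ip z a.
Proof.
move=> d0 [a0 Aa0] Acvx Ad AM.
have M0 : 0 <= M.
  apply: le_trans (AM _ _ Aa0 Aa0).
  by rewrite subrr -(scale0r (a0 : V)) ipZ mul0r.
pose N := [set ip a a | a in A].
have infN : has_inf N.
  by split; [exists (ip a0 a0), a0|exists d => _ [a Aa <-]; exact: Ad].
(* [t] is the step along the segment and [t ^+ 2] the slack allowed in the infimum. Comparing norms
   gives [2 * ip z w >= - t * (M + 1)], and [t * (M + 1) = d - t * d < d], so [ip z a] exceeds
   [d / 2]. *)
pose t := d / (d + 1 + M).
have t0 : 0 < t by rewrite divr_gt0//; lra.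
have tE : t * (d + 1 + M) = d by rewrite /t divfK// gt_eqF//; lra.
have t1 : t <= 1 by rewrite ler_pdivrMr; lra.
have [_ [z Az <-] zt] := inf_adherent (exprn_gt0 2 t0) infN.
exists z => // a Aa.
have := AM _ _ Az Aa; set w := a - z => wM.
have aE : a = z + w by rewrite /w addrC subrK.
clearbody w.
have : inf N <= ip ((1 - t) *: z + t *: a) ((1 - t) *: z + t *: a).
  apply: ge_inf; first exact: infN.2.
  by exists ((1 - t) *: z + t *: a) => //; apply: Acvx => //; rewrite t1 ltW.
have -> : (1 - t) *: z + t *: a = z + t *: w.
  by rewrite aE scalerDr addrA -scalerDl subrK scale1r.
rewrite aE ipD !ipDr !ipZ !ipZr (ipC w z) => h.
have := Ad _ Az => zd.
have h1 : t * (t * ip w w) <= t * (t * M) by rewrite !ler_pM2l.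
have h2 : 0 <= t * (2 * ip z w + t * M + t).
  rewrite -/t; move: h zt; set i := inf N; lra.
move: h2; rewrite pmulr_rge0// => h2.
have td : 0 < t * d by rewrite mulr_gt0.
lra.
Qed.

End separation.

(** * The trace inner product and the Frobenius norm *)

Section frobenius_inner_product.
Context {R : realType}.

Definition mxdot m n (A B : 'M[R]_(m, n)) : R := \tr (A^T *m B).

Section fixed_size.
Context {m n : nat}.
Implicit Types A B C : 'M[R]_(m, n).

Lemma mxdotE A B : mxdot A B = \sum_i \sum_j A i j * B i j.
Proof.
rewrite /mxdot /mxtrace exchange_big/=; apply: eq_bigr => i _.
by rewrite !mxE; apply: eq_bigr => j _; rewrite !mxE.
Qed.

Lemma mxdotC A B : mxdot A B = mxdot B A.
Proof. by rewrite /mxdot -mxtrace_tr trmx_mul trmxK. Qed.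

Lemma mxdotDl A B C : mxdot (A + B) C = mxdot A C + mxdot B C.
Proof. by rewrite /mxdot linearD/= mulmxDl mxtraceD. Qed.

Lemma mxdotZl a A B : mxdot (a *: A) B = a * mxdot A B.
Proof. by rewrite /mxdot linearZ/= -scalemxAl mxtraceZ. Qed.

Lemma mxdotNl A B : mxdot (- A) B = - mxdot A B.
Proof. by rewrite -scaleN1r mxdotZl mulN1r. Qed.

Lemma mxdotDr A B C : mxdot C (A + B) = mxdot C A + mxdot C B.
Proof. by rewrite /mxdot mulmxDr mxtraceD. Qed.

Lemma mxdotZr a A B : mxdot B (a *: A) = a * mxdot B A.
Proof. by rewrite /mxdot -scalemxAr mxtraceZ. Qed.

Lemma mxdotNr A B : mxdot B (- A) = - mxdot B A.
Proof. by rewrite -scaleN1r mxdotZr mulN1r. Qed.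

Lemma mxdot_ge0 A : 0 <= mxdot A A.
Proof.
by rewrite mxdotE; do 2!apply: sumr_ge0 => ? _; rewrite -expr2 sqr_ge0.
Qed.

Lemma frobeniusE A : frobenius A = Num.sqrt (mxdot A A).
Proof.
by rewrite /frobenius mxdotE; congr Num.sqrt; do 2!apply: eq_bigr => ? _.
Qed.

Lemma frobenius_ge0 A : 0 <= frobenius A.
Proof. exact: sqrtr_ge0. Qed.

Lemma sqr_frobenius A : frobenius A ^+ 2 = mxdot A A.
Proof. by rewrite frobeniusE sqr_sqrtr// mxdot_ge0. Qed.

Lemma frobeniusZ a A : 0 <= a -> frobenius (a *: A) = a * frobenius A.
Proof.
move=> a0; rewrite !frobeniusE mxdotZl mxdotZr mulrA -expr2.
by rewrite sqrtrM ?sqr_ge0// sqrtr_sqr ger0_norm.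
Qed.

Lemma frobeniusN A : frobenius (- A) = frobenius A.
Proof. by rewrite !frobeniusE mxdotNl mxdotNr opprK. Qed.

Lemma frobenius0 : frobenius (0 : 'M[R]_(m, n)) = 0.
Proof. by rewrite -(scale0r 0) frobeniusZ// mul0r. Qed.

Lemma mxdot_cauchy_schwarz A B : mxdot A B <= frobenius A * frobenius B.
Proof.
have [A0 B0] := (frobenius_ge0 A, frobenius_ge0 B).
have key (t : R) : 0 <= frobenius A ^+ 2 - 2 * t * mxdot A B
                        + t ^+ 2 * frobenius B ^+ 2.
  have := mxdot_ge0 (A - t *: B).
  rewrite mxdotDl !mxdotDr !mxdotNl !mxdotNr !mxdotZl !mxdotZr.
  by rewrite (mxdotC B A) !sqr_frobenius; nra.
have [B00|Bpos] := eqVneq (frobenius B) 0.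
  rewrite B00 mulr0 leNgt; apply/negP => AB.
  (* For a vanishing [B] the quadratic in [key] is affine in its parameter, and this value makes it
     equal to -1. *)
  have := key ((frobenius A ^+ 2 + 1) / (2 * mxdot A B)).
  have -> : 2 * ((frobenius A ^+ 2 + 1) / (2 * mxdot A B)) * mxdot A B
           = frobenius A ^+ 2 + 1 by field; lra.
  by rewrite B00; lra.
have {Bpos}B0 : 0 < frobenius B by rewrite lt_def Bpos.
rewrite leNgt; apply/negP => AB.
have := key (mxdot A B / frobenius B ^+ 2).
have -> : frobenius A ^+ 2 - 2 * (mxdot A B / frobenius B ^+ 2) * mxdot A B +
  (mxdot A B / frobenius B ^+ 2) ^+ 2 * frobenius B ^+ 2 =
  ((frobenius A * frobenius B) ^+ 2 - mxdot A B ^+ 2) / frobenius B ^+ 2.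
  by field; lra.
rewrite pmulr_lge0 ?invr_gt0 ?exprn_gt0// subr_ge0 leNgt => /negP; apply.
by rewrite ltr_pXn2r// nnegrE ?mulr_ge0//; nra.
Qed.

Lemma frobeniusD A B : frobenius (A + B) <= frobenius A + frobenius B.
Proof.
rewrite -(@ler_pXn2r _ 2)// ?nnegrE ?addr_ge0 ?frobenius_ge0//.
rewrite sqr_frobenius mxdotDl !mxdotDr (mxdotC B A) -!sqr_frobenius.
by have := mxdot_cauchy_schwarz A B; nra.
Qed.

End fixed_size.

Lemma mxdot_tr m n (A B : 'M[R]_(m, n)) : mxdot A^T B^T = mxdot A B.
Proof. by rewrite /mxdot trmxK mxtrace_mulC -mxtrace_tr trmx_mul trmxK. Qed.

Lemma mxtrace_mxdot n (A B : 'M[R]_n) : \tr (A *m B) = mxdot A^T B.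
Proof. by rewrite /mxdot trmxK. Qed.

End frobenius_inner_product.

(** * Duality for a linear form on a convex set intersected with a norm ball *)

Section ball_duality.
Context {R : realType} {n : nat}.
Variables (C : set 'M[R]_n) (Om Q : 'M[R]_n) (eps D V V' : R).
Hypotheses (eps0 : 0 < eps) (COm : C Om) (VV' : V < V').
Hypothesis Csym : forall M, C M -> M^T = M.
Hypothesis Ccvx : forall M N t, C M -> C N -> 0 <= t <= 1 ->
  C ((1 - t) *: M + t *: N).
Hypothesis Cbnd : forall M, C M -> frobenius M <= D.
Hypothesis CV : forall M, C M -> frobenius (M - Om) <= eps -> mxdot Q M <= V.

(* Pulling [M] back to the ball along the segment towards [Om] shows that [V]
   is exceeded by at most a multiple of the distance from [M] to the ball. *)
Lemma mxdot_near_ball M (rho : R) : C M -> 0 <= rho ->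
  frobenius (M - Om) <= eps + rho ->
  mxdot Q M <= V + (V - mxdot Q Om) / eps * rho.
Proof.
move=> CM rho0 Mrho.
pose l := eps / (eps + rho).
have er0 : 0 < eps + rho by rewrite ltr_pwDl.
have l0 : 0 < l by rewrite divr_gt0.
have l1 : l <= 1 by rewrite ler_pdivrMr// mul1r lerDl.
have ME : (1 - l) *: Om + l *: M = Om + l *: (M - Om).
  by apply/matrixP => i j; rewrite !mxE; ring.
have l01 : 0 <= l <= 1 by rewrite l1 ltW.
have := CV (Ccvx COm CM l01); rewrite ME.
have -> : Om + l *: (M - Om) - Om = l *: (M - Om) by rewrite [Om + _]addrC addrK.
rewrite frobeniusZ ?(ltW l0)// => h.
have {}h : mxdot Q (Om + l *: (M - Om)) <= V.
  by apply: h; rewrite /l mulrAC ler_pdivrMr// ler_pM2l.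
move: h; rewrite mxdotDr mxdotZr mxdotDr mxdotNr => h.
have lE : 1 / l = (eps + rho) / eps by rewrite /l; field; rewrite !gt_eqF.
have -> : mxdot Q M = mxdot Q Om + 1 / l * (l * (mxdot Q M - mxdot Q Om)).
  by field; rewrite gt_eqF.
have -> : V + (V - mxdot Q Om) / eps * rho =
   mxdot Q Om + 1 / l * (V - mxdot Q Om) by rewrite lE; field; rewrite gt_eqF.
by rewrite lerD2l ler_pM2l ?divr_gt0//; lra.
Qed.

(** The origin is separated from the pairs [(M - Om - E, V' - mxdot Q M)] with [E] in the ball of
    radius [eps]. Dividing the normal by minus its scalar component gives [Z], and the worst [E] for
    this [Z] produces the term [eps * frobenius Z]. *)
Lemma ball_duality :
  exists Z, Z^T = Z /\ forall M, C M ->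
    mxdot (Q + Z) M - mxdot Z Om + eps * frobenius Z <= V'.
Proof.
pose ip (u v : 'M[R]_n * R^o) : R := mxdot u.1 v.1 + (u.2 : R) * (v.2 : R).
have ipC u v : ip u v = ip v u by rewrite /ip mxdotC mulrC.
have ipD u v w : ip (u + v) w = ip u w + ip v w.
  by rewrite /ip /= mxdotDl mulrDl addrACA.
have ipZ a u v : ip (a *: u) v = a * ip u v.
  by rewrite /ip /= mxdotZl -mulrA -mulrDr.
(* Restricting [E] to symmetric matrices makes the normal symmetric, since the separation result
   finds it inside [A]. *)
pose A : set ('M[R]_n * R^o) := [set u | exists M E,
   [/\ C M, E^T = E, frobenius E <= eps & u = (M - Om - E, V' - mxdot Q M)]].
pose g := V' - V.
have g0 : 0 < g by rewrite subr_gt0.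
have q0V : mxdot Q Om <= V by apply: CV => //; rewrite subrr frobenius0 ltW.
pose k := (V - mxdot Q Om) / eps.
have k0 : 0 <= k by rewrite divr_ge0 ?subr_ge0 // ltW.
(* With this [h], either the first component of a pair has norm at least [h], or [mxdot_near_ball]
   leaves a second component of at least [g - k * h >= h]. *)
pose h := g / (2 * (1 + k)).
have h0 : 0 < h by rewrite divr_gt0//; lra.
have hE : 2 * (1 + k) * h = g by rewrite /h mulrC divfK// gt_eqF//; lra.
have [|||u [M [E [CM Es Ee ->]]]|_ _ [M [E [CM Es Ee ->]]] [M' [E' [CM' Es' Ee' ->]]]|
  z [M0 [E0 [CM0 E0s E0e zE]]] zA] :=
  @bounded_convex_separation R _ ip ipC ipD ipZ A (h ^+ 2)
    ((2 * (D + eps)) ^+ 2 + (2 * D * frobenius Q) ^+ 2).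
- by rewrite exprn_gt0.
- by exists (Om - Om - 0, V' - mxdot Q Om), Om, 0; rewrite trmx0 frobenius0 ltW.
- move=> _ _ t [M [E [CM Es Ee ->]]] [M' [E' [CM' Es' Ee' ->]]] t01.
  exists ((1 - t) *: M + t *: M'), ((1 - t) *: E + t *: E'); split.
  + exact: Ccvx.
  + by rewrite linearD/= !linearZ/= Es Es'.
  + apply: (le_trans (frobeniusD _ _)); case/andP: t01 => t0 t1.
    by rewrite !frobeniusZ ?subr_ge0//; nra.
  + congr (_, _) => /=.
      apply/matrixP => i j; rewrite !mxE; ring.
    by rewrite mxdotDr !mxdotZr /GRing.scale/=; ring.
- rewrite /ip/= -sqr_frobenius -expr2.
  set rho := frobenius _.
  have rho0 : 0 <= rho by exact: frobenius_ge0.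
  have Mrho : frobenius (M - Om) <= eps + rho.
    rewrite -(subrK E (M - Om)); apply: (le_trans (frobeniusD _ _)).
    by rewrite addrC lerD2r.
  have := mxdot_near_ball CM rho0 Mrho; rewrite -/k => QM.
  have [hrho|rhoh] := leP h rho.
    have : h ^+ 2 <= rho ^+ 2 by rewrite ler_pXn2r// nnegrE ltW.
    by have := sqr_ge0 (V' - mxdot Q M); lra.
  have kr : k * rho <= k * h by rewrite ler_wpM2l// ltW.
  have kh : 0 <= k * h by rewrite mulr_ge0// ltW.
  have hQ : h <= V' - mxdot Q M by rewrite /g in hE; lra.
  have : h ^+ 2 <= (V' - mxdot Q M) ^+ 2.
    by rewrite ler_pXn2r// nnegrE ltW// (lt_le_trans h0).
  by have := sqr_ge0 rho; lra.
- rewrite /ip/= -sqr_frobenius -expr2.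
  have [fM fM'] := (Cbnd CM, Cbnd CM').
  have Q0 := frobenius_ge0 Q.
  have D0 : 0 <= D by apply: le_trans fM; exact: frobenius_ge0.
  have De0 : 0 <= 2 * (D + eps) by rewrite mulr_ge0// addr_ge0// ltW.
  have DQ0 : 0 <= 2 * D * frobenius Q by rewrite !mulr_ge0.
  have h1 : frobenius (M' - Om - E' - (M - Om - E)) <= 2 * (D + eps).
    have -> : M' - Om - E' - (M - Om - E) = (M' - M) + (E - E').
      by apply/matrixP => i j; rewrite !mxE; ring.
    have := frobeniusD (M' - M) (E - E').
    have := frobeniusD M' (- M); have := frobeniusD E (- E').
    by rewrite !frobeniusN; lra.
  have h2 : `|V' - mxdot Q M' - (V' - mxdot Q M)| <= 2 * D * frobenius Q.
    have -> : V' - mxdot Q M' - (V' - mxdot Q M) = mxdot Q (M - M').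
      by rewrite mxdotDr mxdotNr; ring.
    have fMM : frobenius (M - M') <= 2 * D.
      by have := frobeniusD M (- M'); rewrite frobeniusN; lra.
    have h2 : frobenius Q * frobenius (M - M') <= frobenius Q * (2 * D).
      by rewrite ler_wpM2l.
    rewrite ler_norml; apply/andP; split.
      rewrite lerNl -mxdotNr; have := mxdot_cauchy_schwarz Q (- (M - M')).
      by rewrite frobeniusN; lra.
    by have := mxdot_cauchy_schwarz Q (M - M'); lra.
  apply: lerD; first by rewrite ler_pXn2r// nnegrE frobenius_ge0.
  by rewrite -[leLHS]real_normK ?num_real ?ler_pXn2r ?nnegrE.
(* The pair built from [Om] and [E = 0] has zero matrix component, so only the scalar one
   contributes to its positive product with [z]. *)
have tau0 : 0 < z.2.
  have := zA (Om - Om - 0, V' - mxdot Q Om) (ex_intro _ Om (ex_intro _ 0 _)).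
  rewrite trmx0 frobenius0 ltW// => /(_ (And4 COm erefl isT erefl)).
  rewrite /ip/= !subrr mxdotC -(scale0r Om) mxdotZl mul0r add0r pmulr_lgt0//.
  by rewrite subr_gt0 (le_lt_trans q0V).
pose Z := - (z.2 : R)^-1 *: z.1.
have Zs : Z^T = Z.
  rewrite /Z linearZ/= zE/= !linearD/= !linearN/= E0s.
  by rewrite !Csym.
exists Z; split => // M CM.
(* The point of the ball opposite to [Z]; when [Z] has norm 0, division by zero returns 0 and [E] is
   0. *)
pose E := - (eps / frobenius Z) *: Z.
have Es : E^T = E by rewrite /E linearZ/= Zs.
have Ee : frobenius E <= eps.
  have eZ0 : 0 <= eps / frobenius Z by rewrite divr_ge0 ?frobenius_ge0// ltW.
  rewrite /E scaleNr frobeniusN frobeniusZ//.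
  have [->|Z0] := eqVneq (frobenius Z) 0; first by rewrite mulr0; exact: ltW.
  by rewrite divfK.
have ZE : mxdot Z E = - (eps * frobenius Z).
  rewrite /E mxdotZr -sqr_frobenius mulNr.
  have [->|Z0] := eqVneq (frobenius Z) 0; first by rewrite expr0n/= !mulr0.
  by rewrite expr2 mulrA divfK.
have := zA _ (ex_intro _ M (ex_intro _ E (And4 CM Es Ee erefl))).
rewrite /ip/=; have -> : z.1 = - z.2 *: Z.
  by rewrite /Z scalerA mulrNN divff ?gt_eqF// scale1r.
rewrite mxdotZl mulNr addrC -mulrBr pmulr_rgt0//.
by rewrite !mxdotDr !mxdotNr ZE mxdotDl => ?; lra.
Qed.

End ball_duality.

(** * Strong duality over the chi-square ball of weights *)

Section chi_square_duality.
Context {R : realType} {K : nat}.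
Variables (ph s : 'I_K -> R) (gamma V : R).
Hypotheses (ph0 : forall k, 0 < ph k) (ph1 : \sum_k ph k = 1).
Hypothesis gamma0 : 0 <= gamma.
Hypothesis weak : forall p : 'I_K -> R, (forall k, 0 < p k) ->
  \sum_k p k = 1 -> \sum_k (p k - ph k) ^+ 2 / p k <= gamma ->
  \sum_k p k * s k <= V.

(** The derivative of [num] is [den / 2], so [num t * den t = gamma + 1] is the stationarity
    condition for [t - num t ^+ 2 / (gamma + 1)]. *)
Let num t := \sum_k ph k * Num.sqrt (t - s k).
Let den t := \sum_k ph k / Num.sqrt (t - s k).

(* Minimising over [omega] for a fixed [t = omega - eta] gives
   [sqrt omega = num t / (gamma + 1)]. *)
Lemma chi_square_dual_point t : (forall k, s k <= t) ->
  exists eta omega (r : 'I_K -> R),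
  [/\ 0 <= omega,
     forall k, s k + eta <= omega /\
       Num.sqrt (4 * r k ^+ 2 + (s k + eta) ^+ 2) <= 2 * omega - s k - eta &
     gamma * omega - eta - 2 * (\sum_k ph k * r k) + 2 * omega
     = t - num t ^+ 2 / (gamma + 1)].
Proof.
have g0 := gamma0; move=> st; pose w := num t / (gamma + 1).
have G0 : gamma + 1 != 0 by rewrite gt_eqF//; lra.
exists (w ^+ 2 - t), (w ^+ 2), (fun k => w * Num.sqrt (t - s k)); split.
- exact: sqr_ge0.
- move=> k; have stk := st k; split; first lra.
  have y0 : 0 <= t - s k by rewrite subr_ge0.
  rewrite exprMn sqr_sqrtr//.
  have -> : 4 * (w ^+ 2 * (t - s k)) + (s k + (w ^+ 2 - t)) ^+ 2
          = (w ^+ 2 + (t - s k)) ^+ 2 by ring.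
  rewrite sqrtr_sqr (ger0_norm (addr_ge0 (sqr_ge0 w) y0)) le_eqVlt.
  by apply/orP; left; apply/eqP; ring.
- rewrite /=; have -> : \sum_k ph k * (w * Num.sqrt (t - s k)) = w * num t.
    by rewrite mulr_sumr; apply: eq_bigr => k _; ring.
  by rewrite /w; field.
Qed.

(* At [t] with [num t * den t = gamma + 1], the weights
   [ph k / (den t * sqrt (t - s k))] attain the dual value. *)
Lemma chi_square_primal_point t : (forall k, s k < t) ->
  num t * den t = gamma + 1 -> t - num t ^+ 2 / (gamma + 1) <= V.
Proof.
have g0 := gamma0; move=> st nd.
have y0 k : 0 < Num.sqrt (t - s k) by rewrite sqrtr_gt0 subr_gt0.
have ysq k : Num.sqrt (t - s k) ^+ 2 = t - s k.
  by rewrite sqr_sqrtr// subr_ge0 ltW.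
have den0 : 0 < den t.
  rewrite lt_def sumr_ge0 ?andbT; last by move=> k _; rewrite ltW// divr_gt0.
  by apply/eqP => d0; move: nd; rewrite d0 mulr0; lra.
pose p k := ph k / (den t * Num.sqrt (t - s k)).
have p0 k : 0 < p k by rewrite divr_gt0// mulr_gt0.
have psum (f : 'I_K -> R) :
    \sum_k p k * f k = (\sum_k ph k / Num.sqrt (t - s k) * f k) / den t.
  rewrite mulr_suml; apply: eq_bigr => k _; rewrite /p; field.
  by rewrite !gt_eqF.
have psum1 : \sum_k p k = 1.
  transitivity (\sum_k p k * 1); first by apply: eq_bigr => k _; rewrite mulr1.
  rewrite psum; under eq_bigr do rewrite mulr1.
  by rewrite -/(den t) divff// gt_eqF.
have -> : t - num t ^+ 2 / (gamma + 1) = \sum_k p k * s k.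
  have -> : \sum_k p k * s k = \sum_k (p k * t - p k * (t - s k)).
    by apply: eq_bigr => k _; ring.
  rewrite sumrB -mulr_suml psum1 mul1r psum; congr (_ - _).
  have -> : \sum_k ph k / Num.sqrt (t - s k) * (t - s k) = num t.
    apply: eq_bigr => k _; rewrite -[in X in _ * X]ysq; field.
    by rewrite gt_eqF.
  by rewrite -nd; field; rewrite gt_eqF//=; apply/eqP => n0;
     move: nd; rewrite n0 mul0r; lra.
apply: weak => //.
(* Expanding the square, the chi-square distance sums to [1 - 2 + num t * den t], which is
   [gamma]. *)
have -> : \sum_k (p k - ph k) ^+ 2 / p k
        = \sum_k (p k - 2 * ph k + ph k * Num.sqrt (t - s k) * den t).
  apply: eq_bigr => k _; rewrite /p; field.
  by rewrite !gt_eqF.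
rewrite big_split/= sumrB psum1 -mulr_sumr ph1 -mulr_suml -/(num t) nd; lra.
Qed.

Let bound_s : exists2 c, 0 <= c & forall k, `|s k| <= c.
Proof.
exists (\sum_k `|s k|); first by apply: sumr_ge0 => k _; exact: normr_ge0.
by move=> k; rewrite (bigD1 k)//= lerDl sumr_ge0.
Qed.

Lemma sum_ph_bounds (f : 'I_K -> R) a b :
  (forall k, a <= f k <= b) -> a <= \sum_k ph k * f k <= b.
Proof.
move=> fab; apply/andP; split.
  rewrite -[a]mul1r -ph1 mulr_suml ler_sum// => k _.
  by rewrite ler_pM2l//; have /andP[] := fab k.
rewrite -[b]mul1r -ph1 mulr_suml ler_sum// => k _.
by rewrite ler_pM2l//; have /andP[] := fab k.
Qed.

(* For [t = c + u^2] all the square roots lie in [u, u + c / u], so [num t] is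
   close to each of them when [u] is large. *)
Lemma sqrt_window c u : (forall k, `|s k| <= c) -> 0 < u ->
  forall k, u <= Num.sqrt (c + u ^+ 2 - s k) <= u + c / u.
Proof.
move=> sc u0 k; have := sc k; rewrite ler_norml => /andP[s1 s2].
have c0 : 0 <= c by apply: le_trans (sc k).
have cu0 : 0 <= c / u by rewrite divr_ge0// ltW.
apply/andP; split.
  by rewrite -[leLHS](ger0_norm (ltW u0)) -sqrtr_sqr ler_wsqrtr//; lra.
rewrite -[leRHS]ger0_norm; last by rewrite addr_ge0// ltW.
rewrite -sqrtr_sqr ler_wsqrtr//.
have -> : (u + c / u) ^+ 2 = u ^+ 2 + 2 * c + (c / u) ^+ 2.
  by field; rewrite gt_eqF.
by have := sqr_ge0 (c / u); lra.
Qed.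

Lemma num_den_continuous t : (forall k, s k < t) ->
  {for t, continuous (fun x => num x * den x)}.
Proof.
move=> st.
have sq k : {for t, continuous (fun x => Num.sqrt (x - s k))}.
  apply: continuous_comp; last exact: sqrt_continuous.
  by apply: cvgB; [exact: cvg_id|exact: cvg_cst].
apply: continuousM.
  apply: (@cvg_big R 'I_K +%R 0 xpredT); first exact: add_continuous.
  by move=> k _; apply: cvgM; [exact: cvg_cst|exact: sq].
apply: (@cvg_big R 'I_K +%R 0 xpredT); first exact: add_continuous.
move=> k _; apply: cvgM; [exact: cvg_cst|].
by apply: (continuousV _ (sq k)); rewrite gt_eqF// sqrtr_gt0 subr_gt0.
Qed.

(** For [gamma = 0] the dual value is the mean of [s] under [ph] plus the variance of
    [sqrt (t - s k)], which tends to 0 as [t] grows. For [gamma > 0] and constant [s], [t] equal to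
    that constant is exact because [num] vanishes there. Otherwise [num * den] passes from at least
    [gamma + 1] just above the maximum of [s] to at most [gamma + 1] far away, and
    [chi_square_primal_point] applies at a crossing. *)
Lemma chi_square_dual_value e : 0 < e ->
  exists2 t, forall k, s k <= t & t - num t ^+ 2 / (gamma + 1) <= V + e.
Proof.
have gamma_ge0 := gamma0; move=> e0; have [c c0 sc] := bound_s.
have phV : \sum_k ph k * s k <= V.
  apply: weak => //.
  by rewrite big1// => k _; rewrite subrr expr0n/= mul0r.
have [g0|gpos] := eqVneq gamma 0.
  (* Each square root will differ from the mean [num t] by at most [c / u <= m]; as [m <= 1], the
     variance is at most [m ^+ 2 <= m <= e]. *)
  pose m := Num.min 1 e.
  have m0 : 0 < m by rewrite lt_min ltr01 e0.
  pose u := c / m + 1.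
  have cm0 : 0 <= c / m by rewrite divr_ge0// ltW.
  have u0 : 0 < u by rewrite /u; lra.
  have cum : c / u <= m.
    by rewrite ler_pdivrMr// /u mulrDr mulr1 mulrCA divff ?gt_eqF// mulr1 lerDl ltW.
  have win := sqrt_window sc u0.
  exists (c + u ^+ 2) => [k|].
    have := sc k; rewrite ler_norml => /andP[_ ?].
    by have := sqr_ge0 u; lra.
  set t := c + u ^+ 2; rewrite g0 add0r divr1.
  have numw : u <= num t <= u + c / u by exact: sum_ph_bounds.
  have : \sum_k ph k * (Num.sqrt (t - s k) - num t) ^+ 2 <= m.
    suff bnd : forall k, 0 <= (Num.sqrt (t - s k) - num t) ^+ 2 <= m.
      by have /andP[] := sum_ph_bounds bnd.
    move=> k; rewrite sqr_ge0/=.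
    have /andP[y1 y2] := win k; have /andP[n1 n2] := numw.
    have m1 : m <= 1 by rewrite /m ge_min lexx.
    rewrite -/t in y1 y2.
    apply: (@le_trans _ _ (m ^+ 2)).
      rewrite -real_normK ?num_real// ler_pXn2r ?nnegrE ?(ltW m0)//.
      by rewrite ler_norml; apply/andP; split; lra.
    by rewrite expr2 ger_pMr.
  have -> : \sum_k ph k * (Num.sqrt (t - s k) - num t) ^+ 2 =
      \sum_k (ph k * t - ph k * s k - 2 * num t * (ph k * Num.sqrt (t - s k))
        + ph k * num t ^+ 2).
    apply: eq_bigr => k _; rewrite sqrrB sqr_sqrtr; first ring.
    have := sc k; rewrite ler_norml => /andP[_ ?].
    by rewrite /t; have := sqr_ge0 u; lra.
  rewrite big_split/= !sumrB -!mulr_suml ph1 -mulr_sumr -/(num t).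
  have : m <= e by rewrite /m ge_min lexx orbT.
  by lra.
have {gpos}gamma_gt0 : 0 < gamma by rewrite lt_def gpos.
have [K0|[i0 _]] : (forall k : 'I_K, False) \/ exists i0 : 'I_K, True.
- have [|n] := pselect (exists i0 : 'I_K, True); first by right.
  by left => k; apply: n; exists k.
- by move: ph1; rewrite big1 => [/eqP|k]; [rewrite eq_sym oner_eq0|case: (K0 k)].
have [i si] : exists i, forall k, s k <= s i.
  by exists [arg max_(i > i0) s i]%O; case: arg_maxP => // i _ si k; exact: si.
have [sconst|] := pselect (forall k, s k = s i).
  exists (s i) => //; have -> : num (s i) = 0.
    by rewrite /num big1// => k _; rewrite sconst subrr sqrtr0 mulr0.
  rewrite expr0n/= mul0r subr0.
  have -> : s i = \sum_k ph k * s k.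
    under eq_bigr do rewrite sconst.
    by rewrite -mulr_suml ph1 mul1r.
  by lra.
move=> /existsNP[j /eqP sj].
have sji : s j < s i by rewrite lt_def eq_sym sj si.
have ph_le1 k : ph k <= 1.
  by rewrite -ph1 (bigD1 k)//= lerDl sumr_ge0// => l _; exact: ltW.
(* Keeping only the term [j] of [num] and the term [i] of [den] bounds their product at [s i + h]
   below by [ph j * sqrt (s i - s j) * (ph i / sqrt h)]; the choice of [q] and [h] makes this
   exactly [gamma + 1]. *)
pose q := ph i * ph j / (gamma + 1).
have q0 : 0 < q by rewrite divr_gt0 ?mulr_gt0//; lra.
have q1 : q <= 1.
  rewrite ler_pdivrMr ?mul1r; last lra.
  have : ph i * ph j <= 1 by rewrite mulr_ile1// ltW.
  by lra.
pose h := (s i - s j) * q ^+ 2.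
have h0 : 0 < h by rewrite mulr_gt0 ?exprn_gt0// subr_gt0.
have hij : h <= s i - s j by rewrite ger_pMr ?subr_gt0// exprn_ile1// ltW.
(* The summand [c / gamma] gives [c / u ^+ 2 <= gamma] at the right end point, [2 * c] puts that end
   point beyond [s i + h], and 1 ensures [u <= u ^+ 2]. *)
pose u := c / gamma + 2 * c + 1.
have cg0 : 0 <= c / gamma by rewrite divr_ge0.
have u1 : 1 <= u by rewrite /u; lra.
have u0 : 0 < u by lra.
have uu : u <= u ^+ 2 by rewrite expr2 ler_pMr.
have := sc i; have := sc j; rewrite !ler_norml => /andP[sj1 sj2] /andP[si1 si2].
have lt01 : s i + h <= c + u ^+ 2 by move: uu; rewrite {1}/u; lra.
have cont : {within `[s i + h, c + u ^+ 2], continuous (fun x => num x * den x)}.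
  apply: continuous_in_subspaceT => x; rewrite inE/= in_itv/= => /andP[hx _].
  apply: num_den_continuous => k.
  by have := si k; lra.
have F0 : gamma + 1 <= num (s i + h) * den (s i + h).
  have yj0 : 0 < s i + h - s j by lra.
  have numj : ph j * Num.sqrt (s i + h - s j) <= num (s i + h).
    rewrite /num (bigD1 j)//= lerDl sumr_ge0// => k _.
    by rewrite mulr_ge0 ?sqrtr_ge0// ltW.
  have deni : ph i / Num.sqrt h <= den (s i + h).
    rewrite /den (bigD1 i)//= addrAC subrr add0r lerDl sumr_ge0// => k _.
    by rewrite divr_ge0 ?sqrtr_ge0// ltW.
  apply: le_trans (ler_pM _ _ numj deni); last 2 first.
  - by rewrite mulr_ge0 ?sqrtr_ge0// ltW.
  - by rewrite divr_ge0 ?sqrtr_ge0// ltW.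
  have sh : Num.sqrt h = Num.sqrt (s i - s j) * q.
    by rewrite /h sqrtrM ?subr_ge0 ?(ltW sji)// sqrtr_sqr gtr0_norm.
  have sij0 : 0 < Num.sqrt (s i - s j) by rewrite sqrtr_gt0 subr_gt0.
  have -> : gamma + 1 = ph j * Num.sqrt (s i - s j) * (ph i / Num.sqrt h).
    by rewrite sh /q; field; rewrite !gt_eqF//; lra.
  rewrite ler_wpM2r ?divr_ge0 ?sqrtr_ge0 ?(ltW (ph0 i))//.
  by rewrite ler_wpM2l ?(ltW (ph0 j))// ler_wsqrtr//; lra.
have F1 : num (c + u ^+ 2) * den (c + u ^+ 2) <= gamma + 1.
  have win := sqrt_window sc u0.
  have /andP[n0 n1] : u <= num (c + u ^+ 2) <= u + c / u by exact: sum_ph_bounds.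
  have /andP[d0 d1] : 0 <= den (c + u ^+ 2) <= u^-1.
    apply: sum_ph_bounds => k; have /andP[y1 _] := win k.
    by rewrite invr_ge0 sqrtr_ge0/= lef_pV2// posrE (lt_le_trans u0).
  apply: (@le_trans _ _ ((u + c / u) * u^-1)).
    by rewrite ler_pM// (le_trans _ n0)// ltW.
  have -> : (u + c / u) * u^-1 = 1 + c / u ^+ 2 by field; rewrite gt_eqF.
  rewrite addrC lerD2r ler_pdivrMr ?exprn_gt0//.
  rewrite -ler_pdivrMl// mulrC (le_trans _ uu)// /u; lra.
have [|t] := @IVT R _ _ _ (gamma + 1) lt01 cont.
  by rewrite ge_min F1 orbT/= le_max F0.
rewrite in_itv/= => /andP[t0 _] ft.
have st k : s k < t by have := si k; lra.
exists t => [k|]; first exact: ltW.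
by have := chi_square_primal_point st ft; lra.
Qed.

Lemma chi_square_duality e : 0 < e ->
  exists eta omega (r : 'I_K -> R),
  [/\ 0 <= omega,
     forall k, s k + eta <= omega /\
       Num.sqrt (4 * r k ^+ 2 + (s k + eta) ^+ 2) <= 2 * omega - s k - eta &
     gamma * omega - eta - 2 * (\sum_k ph k * r k) + 2 * omega <= V + e].
Proof.
move=> /chi_square_dual_value[t st tV].
have [et [omega [r [w0 cons obj]]]] := chi_square_dual_point st.
by exists et, omega, r; split; rewrite ?obj.
Qed.

End chi_square_duality.

(** * Finite mixtures of probability measures and their integrals *)

Section mixtures.
Context d (T : measurableType d) (R : realType).

(** The weighted sum has total mass 1, so [mnormalize] leaves its values unchanged and supplies the
    probability structure; [m k0] is the fallback measure it asks for. Since [msum] runs over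
    natural numbers, indices out of range receive [mzero]. *)
Lemma mixture_probability n (p : 'I_n -> R) (m : 'I_n -> probability T R) :
  (forall k, 0 <= p k) -> \sum_k p k = 1 ->
  exists P : probability T R, forall A,
    P A = (\sum_k (p k)%:E * m k A)%E.
Proof.
move=> p0 p1.
have [k0 _] : exists k0 : 'I_n, True.
  apply: contrapT => nk; move: p1; rewrite big1 => [/eqP|k _].
    by rewrite eq_sym oner_eq0.
  by case: nk; exists k.
pose q k : {nonneg R} := NngNum (p0 k).
pose mu (j : nat) : {measure set T -> \bar R} :=
  if insub j is Some k then mscale (q k) (m k) else mzero.
have muE A : msum mu n A = (\sum_k (p k)%:E * m k A)%E.
  by apply: eq_bigr => k _; rewrite /mu valK.
have mu1 : msum mu n setT = 1%E.
  rewrite muE; under eq_bigr do rewrite probability_setT mule1.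
  by rewrite sumEFin p1.
exists (mnormalize (msum mu n) (m k0)) => A.
have /= := mu1; rewrite /mnormalize/= => ->.
by rewrite onee_eq0/= invr1 mule1 -muE.
Qed.

(** Additivity in the measure holds for non-negative functions, and integrability lets the positive
    and negative parts be subtracted. Measures are compared only on subsets of [D], so that [D] may
    be a cell on which a mixture reduces to one component. *)
Lemma integral_mixture n (p : 'I_n -> R) (m : 'I_n -> {measure set T -> \bar R})
    (mu : {measure set T -> \bar R}) D (f : T -> \bar R) :
  measurable D -> (forall k, 0 <= p k) ->
  (forall A, measurable A -> A `<=` D -> mu A = \sum_k (p k)%:E * m k A)%E ->
  (forall k, (m k).-integrable D f) -> measurable_fun D f ->
  (\int[mu]_(x in D) f x = \sum_k (p k)%:E * \int[m k]_(x in D) f x)%E.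
Proof.
move=> mD p0 muE intf mf.
pose q k : {nonneg R} := NngNum (p0 k).
pose nu (j : nat) : {measure set T -> \bar R} :=
  if insub j is Some k then mscale (q k) (m k) else mzero.
have nuE A : msum nu n A = (\sum_k (p k)%:E * m k A)%E.
  by apply: eq_bigr => k _; rewrite /nu valK.
have ge0 (g : T -> \bar R) : (forall x, D x -> 0 <= g x)%E -> measurable_fun D g ->
  (\int[msum nu n]_(x in D) g x = \sum_k (p k)%:E * \int[m k]_(x in D) g x)%E.
  move=> g0 mg; rewrite ge0_integral_measure_sum//; apply: eq_bigr => k _.
  by rewrite /nu valK ge0_integral_mscale.
rewrite (@eq_measure_integral _ _ _ _ (msum nu n)); last first.
  by move=> A mA AD; rewrite muE// -nuE.
rewrite integralE !ge0//; [|exact: measurable_funeneg|exact: measurable_funepos].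
have fpos k : (\int[m k]_(x in D) f^\+ x)%E \is a fin_num.
  exact: integrable_pos_fin_num.
have fneg k : (\int[m k]_(x in D) f^\- x)%E \is a fin_num.
  exact: integrable_neg_fin_num.
have finE (g : 'I_n -> \bar R) : (forall k, g k \is a fin_num) ->
    (\sum_k (p k)%:E * g k)%E = (\sum_k p k * fine (g k))%:E.
  move=> gfin; rewrite -sumEFin; apply: eq_bigr => k _.
  by rewrite EFinM fineK.
have fE k : (\int[m k]_(x in D) f x =
    (fine (\int[m k]_(x in D) f^\+ x) - fine (\int[m k]_(x in D) f^\- x))%:E)%E.
  by rewrite integralE EFinB !fineK.
rewrite !finE => [|k|//|//]; last by rewrite fE.
rewrite -EFinB -sumrB; congr EFin.
by apply: eq_bigr => k _; rewrite fE mulrBr.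
Qed.

Lemma probability_bounded_integrable (P : probability T R) A (f : T -> R) c :
  measurable A -> P A = 1%E -> measurable_fun setT f ->
  (forall x, A x -> `|f x| <= c) -> P.-integrable setT (EFin \o f).
Proof.
move=> mA PA mf fc.
have NA : P (~` A) = 0%E by rewrite probability_setC// PA subee.
have mEf : measurable_fun setT (EFin \o f) by exact/measurable_EFinP.
apply/(negligible_integrable (measurableC mA) measurableT mEf NA).
rewrite setTD setCK; apply: measurable_bounded_integrable => //.
- by rewrite (le_lt_trans (probability_le1 P mA))// ltry.
- exact: measurable_funTS.
- exists c; split; first exact: num_real.
  by move=> x cx y Ay; apply: le_trans (ltW cx); exact: fc.
Qed.

Lemma probability_integral_restrict (P : probability T R) A (f : T -> \bar R) :
  measurable A -> P A = 1%E -> P.-integrable setT f ->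
  (\int[P]_x f x = \int[P]_(x in A) f x)%E.
Proof.
move=> mA PA intf.
have NA : P (~` A) = 0%E by rewrite probability_setC// PA subee.
by rewrite (negligible_integral (measurableC mA) measurableT intf NA) setTD setCK.
Qed.

End mixtures.

(** * Quadratic forms as inner products with rank-one matrices *)

Section quadratic_forms.
Context {R : realType} {n : nat}.
Implicit Types (A Q : 'M[R]_n) (v : 'cV[R]_n).

Lemma qform_mxdot A v : qform A v = mxdot A (v *m v^T).
Proof.
have s11 (M : 'M[R]_1) : M 0 0 = \tr M by rewrite /mxtrace big_ord1.
by rewrite /qform /mxdot mulmxA mxtrace_mulC s11 -mxtrace_tr !trmx_mul !trmxK mulmxA.
Qed.

Lemma outerE v i j : (v *m v^T) i j = v i 0 * v j 0.
Proof. by rewrite !mxE big_ord1 !mxE. Qed.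

Lemma outer_sym v : (v *m v^T)^T = v *m v^T.
Proof. by rewrite trmx_mul trmxK. Qed.

Lemma qformE A v : qform A v = \sum_i \sum_j A i j * (v i 0 * v j 0).
Proof.
by rewrite qform_mxdot mxdotE; do 2!apply: eq_bigr => ? _; rewrite outerE.
Qed.

Lemma qformD A B v : qform (A + B) v = qform A v + qform B v.
Proof. by rewrite !qform_mxdot mxdotDl. Qed.

Lemma qformZ a A v : qform (a *: A) v = a * qform A v.
Proof. by rewrite !qform_mxdot mxdotZl. Qed.

Lemma qformN A v : qform (- A) v = - qform A v.
Proof. by rewrite !qform_mxdot mxdotNl. Qed.

Lemma qform_tr A v : qform A^T v = qform A v.
Proof. by rewrite !qform_mxdot -[in RHS]mxdot_tr outer_sym. Qed.

Lemma qform_scale A t v : qform A (t *: v) = t ^+ 2 * qform A v.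
Proof.
by rewrite !qform_mxdot linearZ/= -scalemxAr -scalemxAl !mxdotZr mulrA -expr2.
Qed.

Lemma qform_mul m (W Y : 'M[R]_(m, n)) v :
  qform (W^T *m Y) v = dot (W *m v) (Y *m v).
Proof. by rewrite /qform /dot trmx_mul !mulmxA. Qed.

Lemma qform_outer (a b v : 'cV[R]_n) : qform (a *m b^T) v = dot a v * dot b v.
Proof.
rewrite /qform /dot -[in LHS](trmxK a) mulmxA -trmx_mul -mulmxA.
by rewrite mxE big_ord1 !mxE.
Qed.

Lemma qform1_ge0 v : 0 <= qform 1%:M v.
Proof.
rewrite /qform mulmx1 mxE; apply: sumr_ge0 => i _.
by rewrite mxE -expr2 sqr_ge0.
Qed.

Lemma frobenius_outer v : frobenius (v *m v^T) = qform 1%:M v.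
Proof.
rewrite frobeniusE -qform_mxdot.
have -> : qform (v *m v^T) v = qform 1%:M v ^+ 2.
  by rewrite qform_outer /qform mulmx1 /dot -expr2.
by rewrite sqrtr_sqr ger0_norm ?qform1_ge0.
Qed.

(** Cauchy-Schwarz against the rank-one matrix of [v], whose Frobenius norm is the squared Euclidean
    norm [qform 1%:M v]. *)
Lemma qform_le A v : `|qform A v| <= frobenius A * qform 1%:M v.
Proof.
rewrite qform_mxdot -frobenius_outer ler_norml lerNl -mxdotNl.
by rewrite -[X in X * _]frobeniusN mxdot_cauchy_schwarz frobeniusN mxdot_cauchy_schwarz.
Qed.

Lemma qform_delta i j v : qform (delta_mx i j) v = v i 0 * v j 0.
Proof.
rewrite qformE (bigD1 i)//= (bigD1 j)//= mxE !eqxx mul1r !big1 ?addr0//.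
  by move=> k /negPf ki; apply: big1 => l _; rewrite mxE ki/= mul0r.
by move=> l /negPf lj; rewrite mxE lj andbF mul0r.
Qed.

End quadratic_forms.

(** * Second-moment matrices of measures carried by a bounded set *)

Section second_moments.
Context {R : realType} {S : nat}.
Local Notation T := (borel_cV R S).
Implicit Types (P : probability T R) (Q : 'M[R]_S.+1).

Lemma continuous_qform Q : continuous (qform Q : 'cV[R]_S.+1 -> R).
Proof.
have -> : qform Q = fun v : 'cV[R]_S.+1 => \sum_i \sum_j Q i j * (v i 0 * v j 0).
  by apply/funext => w; rewrite qformE.
move=> v; have Fv : Filter (nbhs v) by exact: nbhs_filter.
apply: (@cvg_big R _ +%R 0 xpredT) => [|i _]; first exact: add_continuous.
apply: (@cvg_big R _ +%R 0 xpredT) => [|j _]; first exact: add_continuous.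
apply: cvgM; first exact: cvg_cst.
by apply: cvgM; exact: coord_continuous.
Qed.

Lemma borel_continuous_measurable (f : 'cV[R]_S.+1 -> R) :
  continuous f -> measurable_fun setT (f : T -> R).
Proof.
move=> cf; apply: (measurability _ (RGenOpens.measurableE R)).
move=> _ [_ [x [y ->]] <-]; rewrite setTI.
apply: sub_sigma_algebra.
by have /continuousP := cf; apply; exact: interval_open.
Qed.

Lemma borel_closed_measurable (A : set 'cV[R]_S.+1) :
  closed A -> measurable (A : set T).
Proof.
move=> cA; rewrite -[A]setCK; apply: measurableC.
by apply: sub_sigma_algebra; rewrite /= openC.
Qed.

Variables (D : set T) (c : R).
Hypothesis mD : measurable D.
Hypothesis Dc : forall v, D v -> qform 1%:M v <= c.

Lemma measurable_qform Q (A : set T) :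
  measurable_fun A (fun v : T => (qform Q v)%:E).
Proof.
apply/measurable_EFinP; apply: measurable_funTS.
by apply: borel_continuous_measurable; exact: continuous_qform.
Qed.

Lemma integrable_qform P Q : P D = 1%E ->
  P.-integrable setT (fun v => (qform Q v)%:E).
Proof.
move=> PD; apply: (@probability_bounded_integrable _ _ _ _ D (qform Q)
  (frobenius Q * c)) => //.
  by apply: borel_continuous_measurable; exact: continuous_qform.
move=> v Dv; apply: (le_trans (qform_le _ _)).
by rewrite ler_wpM2l ?frobenius_ge0 ?Dc.
Qed.

Lemma second_momentE P i j : P D = 1%E ->
  (second_moment P i j)%:E = (\int[P]_v (qform (delta_mx i j) v)%:E)%E.
Proof.
move=> PD; rewrite mxE; under eq_integral do rewrite -qform_delta.
by rewrite fineK//; apply: integrable_fin_num => //; exact: integrable_qform.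
Qed.

Lemma integral_qform P Q : P D = 1%E ->
  (\int[P]_v (qform Q v)%:E)%E = (mxdot Q (second_moment P))%:E.
Proof.
move=> PD.
have QE v : (qform Q v)%:E =
    (\sum_i \sum_j (Q i j)%:E * (qform (delta_mx i j) v)%:E)%E.
  rewrite qformE -sumEFin; apply: eq_bigr => i _.
  by rewrite -sumEFin; apply: eq_bigr => j _; rewrite qform_delta.
under eq_integral do rewrite QE.
have intQ i j : P.-integrable setT
    (fun v => (Q i j)%:E * (qform (delta_mx i j) v)%:E)%E.
  by apply: integrableZl => //; exact: integrable_qform.
rewrite integral_sum//; last by move=> i; exact: integrable_sum.
rewrite mxdotE -sumEFin; apply: eq_bigr => i _.
rewrite integral_sum// -sumEFin; apply: eq_bigr => j _.
by rewrite integralZl//; [rewrite EFinM second_momentE|exact: integrable_qform].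
Qed.

Lemma second_moment_sym P : (second_moment P)^T = second_moment P.
Proof.
apply/matrixP => i j; rewrite !mxE; congr fine.
by apply: eq_integral => v _; rewrite mulrC.
Qed.

Lemma second_moment_le P Q (A : set T) a : measurable A -> A `<=` D ->
  P A = 1%E -> (forall v, A v -> qform Q v <= a) ->
  mxdot Q (second_moment P) <= a.
Proof.
move=> mA AD PA Qa.
have PD : P D = 1%E.
  apply/eqP; rewrite eq_le probability_le1//= -PA.
  by apply: le_measure => //; rewrite inE.
rewrite -lee_fin -integral_qform//.
rewrite (probability_integral_restrict mA PA); last exact: integrable_qform.
have <- : (\int[P]_(v in A) (cst a%:E) v = a%:E)%E.
  by rewrite integral_cst// [X in (_ * X)%E]PA mule1.
apply: le_integral => //.
- by apply: (@integrableS _ _ _ _ setT) => //; exact: integrable_qform.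
- by apply: finite_measure_integrable_cst.
- by move=> v; rewrite inE lee_fin; exact: Qa.
Qed.

Lemma second_moment_mixture n (p : 'I_n -> R) (m : 'I_n -> probability T R) P :
  (forall k, 0 <= p k) -> (forall A, P A = \sum_k (p k)%:E * m k A)%E ->
  P D = 1%E -> (forall k, m k D = 1%E) ->
  second_moment P = \sum_k p k *: second_moment (m k).
Proof.
move=> p0 PE PD mD1; apply/matrixP => i j; apply: EFin_inj.
rewrite second_momentE// (@integral_mixture _ _ _ _ p m)//.
- rewrite summxE -sumEFin; apply: eq_bigr => k _.
  by rewrite mxE EFinM second_momentE.
- by move=> A _ _; exact: PE.
- by move=> k; exact: integrable_qform.
- exact: measurable_qform.
Qed.

Lemma second_moment_dirac (a : T) :
  second_moment (\d_a : set T -> \bar R) = (a : 'cV[R]_S.+1) *m a^T.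
Proof.
apply/matrixP => i j; rewrite outerE mxE.
under eq_integral do rewrite -qform_delta.
rewrite integral_dirac//; last exact: measurable_qform.
by rewrite diracT mul1e/= qform_delta.
Qed.

(** Testing the moment matrix against itself gives [frobenius M ^+ 2 <= frobenius M * c]. If the
    norm is 0, a point of [D] shows that [c] is non-negative. *)
Lemma frobenius_second_moment_le P : P D = 1%E ->
  frobenius (second_moment P) <= c.
Proof.
move=> PD; set M := second_moment P.
have : frobenius M ^+ 2 <= frobenius M * c.
  rewrite sqr_frobenius; apply: (@second_moment_le _ _ D) => // v Dv.
  apply: le_trans (ler_norm _) _; apply: (le_trans (qform_le _ _)).
  by rewrite ler_wpM2l ?frobenius_ge0 ?Dc.
have := frobenius_ge0 M; rewrite le_eqVlt => /predU1P[<- _|M0].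
  have [v Dv] : D !=set0.
    by apply/set0P/eqP => D0; move: PD; rewrite D0 measure0 => /eqP;
      rewrite eq_sym onee_eq0.
  by apply: le_trans (Dc Dv); exact: qform1_ge0.
by rewrite expr2 ler_pM2l.
Qed.

End second_moments.

(** * Geometry of the support cone and of the Voronoi cones *)

Section support_geometry.
Context {R : realType} {S : nat}.
Variable cone : set 'cV[R]_S.+1.
Hypothesis cone_supp : support_cone cone.

Lemma dot_sum n (u v : 'cV[R]_n) : dot u v = \sum_i u i 0 * v i 0.
Proof. by rewrite /dot mxE; apply: eq_bigr => i _; rewrite mxE. Qed.

Lemma dotC n (u v : 'cV[R]_n) : dot u v = dot v u.
Proof. by rewrite !dot_sum; apply: eq_bigr => i _; rewrite mulrC. Qed.

Lemma dotZr n a (u v : 'cV[R]_n) : dot u (a *: v) = a * dot u v.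
Proof. by rewrite /dot -scalemxAr mxE. Qed.

Lemma dotDr n (u v w : 'cV[R]_n) : dot u (v + w) = dot u v + dot u w.
Proof. by rewrite /dot mulmxDr mxE. Qed.

Lemma dot_e_last (v : 'cV[R]_S.+1) : dot (e_last S) v = v ord_max 0.
Proof.
rewrite dot_sum (bigD1 ord_max)//= mxE !eqxx mul1r big1 ?addr0//.
by move=> i /negPf im; rewrite mxE im mul0r.
Qed.

Lemma slice_bounded : exists c, forall v, slice cone v -> qform 1%:M v <= c.
Proof.
have [_ [_ _ cpt]] := cone_supp.
have := continuous_compact (continuous_subspaceT (@continuous_qform R S 1%:M)) cpt.
move=> /compact_bounded [M [_ Mb]]; exists (M + 1) => v sv.
apply: le_trans (ler_norm _) _; apply: Mb; first by rewrite ltrDl.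
by exists v.
Qed.

Lemma slice_closed : closed (slice cone).
Proof.
by have [_ [_ _ cpt]] := cone_supp; apply: compact_closed cpt; exact: norm_hausdorff.
Qed.

(** The sum is the midpoint of [2 *: u] and [2 *: v]. *)
Lemma coneD u v : cone u -> cone v -> cone (u + v).
Proof.
have [[_ cvx iscone _] _] := cone_supp => cu cv.
have h0 : 0 <= 2^-1 :> R by rewrite invr_ge0.
have h1 : 2^-1 <= 1 :> R by rewrite invf_le1// ler1n.
have := cvx (2 *: u : convex_lmodType _) (2 *: v : convex_lmodType _) (Itv01 h0 h1).
rewrite !inE => /(_ (iscone _ _ _ cu) (iscone _ _ _ cv)).
rewrite /conv/= /unstable.onem.
have -> : (1 - 2^-1 : R) = 2^-1 by lra.
by rewrite !scalerA mulVf ?pnatr_eq0// !scale1r; apply.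
Qed.

(* A nonzero recession direction of the compact slice would be unbounded. *)
Lemma cone_recession v : cone v -> v ord_max 0 = 0 -> qform 1%:M v = 0.
Proof.
move=> cv v0; have [[_ _ iscone _] [_ [xi0 [cxi xi1]] _]] := cone_supp.
have [c cb] := slice_bounded.
pose nv (w : 'cV[R]_S.+1) := frobenius w.
have nvE w : nv w ^+ 2 = qform 1%:M w.
  by rewrite /nv sqr_frobenius /qform mulmx1 /mxdot /mxtrace big_ord1.
rewrite -nvE; apply/eqP; rewrite expf_eq0/=; apply: contraT => vn0.
have {vn0}vn0 : 0 < nv v by rewrite lt_def vn0 frobenius_ge0.
have bnd t : 0 <= t -> nv (xi0 + t *: v) <= Num.sqrt c.
  move=> t0; rewrite -[leLHS]ger0_norm ?frobenius_ge0// -sqrtr_sqr.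
  rewrite ler_wsqrtr// nvE; apply: cb; split; first exact: coneD cxi (iscone _ _ t0 cv).
  by rewrite dotDr dotZr xi1 dot_e_last v0 mulr0 addr0.
(* The points [xi0 + t *: v] stay in the slice, so the triangle inequality bounds the norm of
   [t *: v] by [Num.sqrt c + nv xi0]; this [t] exceeds the bound by 1. *)
pose t := (Num.sqrt c + nv xi0 + 1) / nv v.
have t0 : 0 <= t.
  by rewrite divr_ge0 ?frobenius_ge0// addr_ge0// addr_ge0 ?sqrtr_ge0 ?frobenius_ge0.
have := bnd t t0.
have : nv (t *: v) <= nv (xi0 + t *: v) + nv xi0.
  have := frobeniusD (xi0 + t *: v) (- xi0).
  by rewrite frobeniusN [xi0 + _]addrC addrK.
rewrite {1}/nv frobeniusZ// -/(nv v) divfK ?gt_eqF//; lra.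
Qed.

Lemma voronoi_cone_scale m (zeta : 'I_m -> 'cV[R]_S.+1) k t v : 0 <= t ->
  voronoi_cone cone zeta k v -> voronoi_cone cone zeta k (t *: v).
Proof.
have [[_ _ iscone _] _] := cone_supp; move=> t0 [cv vv]; split; first exact: iscone.
move=> i ik; rewrite !dotZr.
by have := ler_wpM2l t0 (vv i ik); rewrite mulrCA [t * (_ * _)]mulrCA.
Qed.

Lemma copositive_voronoi_cone m (zeta : 'I_m -> 'cV[R]_S.+1) Xi k A :
  voronoi_partition cone zeta Xi -> A^T = A ->
  (forall v, Xi k v -> 0 <= qform A v) ->
  copositive (voronoi_cone cone zeta k) A.
Proof.
move=> [_ _ _ clXi] AT XiA; split => // v vv.
have clA w : slice (voronoi_cone cone zeta k) w -> 0 <= qform A w.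
  rewrite -clXi; have clsd : closed [set w : 'cV[R]_S.+1 | 0 <= qform A w].
    have -> : [set w : 'cV[R]_S.+1 | 0 <= qform A w] =
              qform A @^-1` [set x | 0 <= x] by [].
    have /continuous_closedP := @continuous_qform R S A; apply.
    exact: closed_ge.
  by move=> /(closureS XiA); rewrite -(closure_id _).1.
have [_ [cpos _ _]] := cone_supp.
(* A vector with last coordinate 0 is a recession direction, on which the form vanishes; any other
   is rescaled into the slice. *)
have := cpos v vv.1; rewrite le_eqVlt => /predU1P[v0|v0].
  have := qform_le A v; rewrite (cone_recession vv.1)// mulr0.
  by rewrite normr_le0 => /eqP->.
have -> : v = v ord_max 0 *: ((v ord_max 0)^-1 *: v).
  by rewrite scalerA divff ?gt_eqF// scale1r.
rewrite qform_scale mulr_ge0 ?sqr_ge0//; apply: clA; split.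
  by apply: voronoi_cone_scale => //; rewrite invr_ge0 ltW.
by rewrite dotZr dot_e_last mulVf ?gt_eqF.
Qed.

End support_geometry.

(** * The ambiguity set in terms of weights and conditional measures *)

Section ambiguity.
Context {R : realType} {S K N : nat}.
Variables (cone : set 'cV[R]_S.+1) (zeta : 'I_K -> 'cV[R]_S.+1).
Variables (Xi : 'I_K -> set 'cV[R]_S.+1) (xihat : 'I_N -> 'cV[R]_S.+1).
Variables (gamma : R) (eps : 'I_K -> R).
Hypothesis cone_supp : support_cone cone.
Hypothesis Xi_part : voronoi_partition cone zeta Xi.
Hypothesis xihat_supp : forall i, slice cone (xihat i).
Hypothesis sampled : forall k, sample_idx Xi xihat k != finset.set0.
Hypothesis eps_ge0 : forall k, 0 <= eps k.

Local Notation T := (borel_cV R S).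
Local Notation D := (slice cone : set T).
Local Notation ph := (phat Xi xihat).
Local Notation Om := (Omegahat Xi xihat).
Implicit Types (P : probability T R).

Lemma cell_measurable k : measurable (Xi k : set T).
Proof. by have [] := Xi_part. Qed.

Lemma cell_sub k : Xi k `<=` slice cone.
Proof. by have [_ _ <- _] := Xi_part; move=> v Xv; exists k. Qed.

Lemma slice_measurable : measurable D.
Proof. exact: borel_closed_measurable (slice_closed cone_supp). Qed.

Lemma cell_disjoint j k v : Xi j v -> Xi k v -> j = k.
Proof.
have [_ /trivIsetP tr _ _] := Xi_part => Xj Xk.
by apply: contrapT => /eqP/(tr j k I I); apply/eqP/set0P; exists v.
Qed.

Lemma probability_slice k P : P (Xi k) = 1%E -> P D = 1%E.
Proof.
move=> Pk; apply/eqP; rewrite eq_le probability_le1/= -?Pk; last exact: slice_measurable.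
apply: le_measure; rewrite ?inE; [exact: cell_measurable|exact: slice_measurable|].
exact: cell_sub.
Qed.

Lemma mem_sample_idx k i : (i \in sample_idx Xi xihat k) = `[< Xi k (xihat i) >].
Proof. by rewrite inE. Qed.

Lemma sample_card_gt0 k : 0 < #|sample_idx Xi xihat k|%:R :> R.
Proof. by rewrite ltr0n card_gt0. Qed.

(** The non-empty slice provides a cell index, and [sampled] then provides a sample in that cell. *)
Lemma sample_size_gt0 : 0 < N%:R :> R.
Proof.
have [_ [_ [xi0 sxi0] _]] := cone_supp; have [_ _ cov _] := Xi_part.
rewrite -cov in sxi0; have [k _ _] := sxi0.
have /set0Pn[i _] := sampled k.
by rewrite ltr0n (leq_ltn_trans (leq0n i)).
Qed.

Lemma phatE k : ph k 0 = #|sample_idx Xi xihat k|%:R / N%:R.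
Proof.
rewrite mxE mulrC; congr (_ / _).
rewrite -sum1_card natr_sum [RHS]big_mkcond/=; apply: eq_bigr => i _.
rewrite mem_sample_idx indicE; case: asboolP => [Xk|nXk].
  by rewrite mem_set.
by rewrite memNset.
Qed.

Lemma phat_gt0 k : 0 < ph k 0.
Proof. by rewrite phatE divr_gt0 ?sample_card_gt0 ?sample_size_gt0. Qed.

Lemma phat_sum1 : \sum_k ph k 0 = 1.
Proof.
under eq_bigr do rewrite mxE.
rewrite -mulr_sumr exchange_big/= (eq_bigr (fun=> 1)) => [|i _].
  by rewrite sumr_const card_ord mulVf// gt_eqF// sample_size_gt0.
have := xihat_supp i; have [_ _ <- _] := Xi_part => -[k _ Xk].
rewrite (bigD1 k)//= indicE mem_set// big1 ?addr0// => j jk.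
rewrite indicE memNset// => Xj; move/eqP: jk; apply.
exact: cell_disjoint Xj Xk.
Qed.

(** [empirical] is a bare set function; presenting it as a mixture of Dirac measures makes the
    results on probabilities available for it. *)
Lemma empirical_probability k : exists2 P : probability T R,
  empirical Xi xihat k = P & P (Xi k) = 1%E /\ second_moment P = Om k.
Proof.
pose I := sample_idx Xi xihat k.
pose p i : R := if i \in I then #|I|%:R^-1 else 0.
have p0 i : 0 <= p i by rewrite /p; case: ifP; rewrite ?invr_ge0.
have psum (V : lmodType R) (F : 'I_N -> V) :
    \sum_i p i *: F i = #|I|%:R^-1 *: \sum_(i in I) F i.
  rewrite scaler_sumr [RHS]big_mkcond/=; apply: eq_bigr => i _.
  by rewrite /p; case: ifP; rewrite ?scale0r.
have p1 : \sum_i p i = 1.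
  have := psum R^o (fun=> 1); rewrite /GRing.scale/=.
  under eq_bigr do rewrite mulr1.
  move=> ->; rewrite sumr_const mulVf// gt_eqF//; exact: sample_card_gt0.
have [P PE] := @mixture_probability _ T R _ p
  (fun i => (\d_(xihat i : T) : probability T R)) p0 p1.
have empE : empirical Xi xihat k = P :> (set T -> \bar R).
  apply/funext => A; rewrite PE /empirical ge0_sume_distrr//= [LHS]big_mkcond/=.
  apply: eq_bigr => i _; rewrite /p -/I.
  by case: ifP => // _; rewrite mul0e.
have PXi : P (Xi k) = 1%E.
  rewrite PE -[RHS]/(1%:E) -p1 -sumEFin; apply: eq_bigr => i _.
  rewrite /p mem_sample_idx; case: asboolP => [Xi_i|_]; last by rewrite mul0e.
  by rewrite [X in (_ * X)%E]diracE mem_set// mule1.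
exists P => //; split=> //.
have [c cb] := slice_bounded cone_supp.
have mD := slice_measurable.
have PD := probability_slice PXi.
rewrite (second_moment_mixture mD cb p0 PE PD); last first.
  by move=> i; rewrite [LHS]diracE mem_set//; exact: xihat_supp.
under eq_bigr do rewrite second_moment_dirac.
exact: psum.
Qed.

Lemma second_moment_empirical k : second_moment (empirical Xi xihat k) = Om k.
Proof. by have [P -> [_ ->]] := empirical_probability k. Qed.

Lemma moment_ballP k P : moment_ball Xi xihat eps k P <->
  P (Xi k) = 1%E /\ frobenius (second_moment P - Om k) <= eps k.
Proof. by rewrite /moment_ball/= second_moment_empirical. Qed.

Lemma empirical_ball k : exists2 P, moment_ball Xi xihat eps k P
  & second_moment P = Om k.
Proof.
have [P _ [PXi PO]] := empirical_probability k; exists P => //.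
by apply/moment_ballP; rewrite PO subrr frobenius0.
Qed.

(** Each [m j] lives on its own cell and the cells are disjoint, so every other component vanishes
    on a subset of [Xi k]. *)
Lemma mixture_cell (p : 'I_K -> R) (m : 'I_K -> probability T R) P k
    (A : set T) :
  (forall j, m j (Xi j) = 1%E) ->
  (forall B, measurable B -> P B = \sum_j (p j)%:E * m j B)%E ->
  measurable A -> A `<=` Xi k -> P A = ((p k)%:E * m k A)%E.
Proof.
move=> mXi PE mA AX; rewrite PE// (bigD1 k)//= big1 ?adde0// => j jk.
suff -> : m j A = 0%E by rewrite mule0.
apply/eqP; rewrite eq_le measure_ge0 andbT.
have <- : m j (~` Xi j) = 0%E.
  by rewrite probability_setC ?mXi ?subee//; exact: cell_measurable.
apply: le_measure; rewrite ?inE//.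
  by apply: measurableC; exact: cell_measurable.
by move=> v Av Xj; move/eqP: jk; apply; exact: cell_disjoint Xj (AX _ Av).
Qed.

Lemma cond_expectation_mixture (p : 'I_K -> R) (m : 'I_K -> probability T R) P k Q :
  (forall j, 0 <= p j) -> (forall j, m j (Xi j) = 1%E) ->
  (forall B, measurable B -> P B = \sum_j (p j)%:E * m j B)%E ->
  (P (Xi k) * cond_expectation P (Xi k) (qform Q))%E =
  (p k * mxdot Q (second_moment (m k)))%:E.
Proof.
move=> p0 mXi PE; have mX := cell_measurable k.
have [c cb] := slice_bounded cone_supp; have mD := slice_measurable.
have PX : P (Xi k) = (p k)%:E.
  by rewrite (mixture_cell mXi PE mX (fun _ => id)) mXi mule1.
have mkD := probability_slice (mXi k).
have intk := integrable_qform mD cb Q mkD.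
rewrite /cond_expectation [P (Xi k)]PX/=.
rewrite (@integral_mixture _ _ _ 1 (fun=> p k) (fun=> m k))//; last 3 first.
- move=> A mA AX; rewrite big_ord1; exact: mixture_cell PE mA AX.
- by move=> _; apply: integrableS intk.
- exact: measurable_qform.
rewrite big_ord1 -(probability_integral_restrict mX (mXi k) intk).
rewrite (integral_qform mD cb Q mkD) -!EFinM; congr EFin.
(* The cell has mass [p k], which cancels the normalising factor; for [p k = 0] both sides are 0. *)
have [->|pk0] := eqVneq (p k) 0; first by rewrite !mul0r.
by field.
Qed.

(** Every [phat] entry is positive, so a zero weight would make its chi-square term infinite. On the
    feasible set the extended sum is therefore a real one. *)
Lemma weight_set_gt0 (p : 'cV[R]_K) : weight_set Xi xihat gamma p ->
  [/\ forall k, 0 < p k 0, \sum_k p k 0 = 1 &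
    \sum_k (p k 0 - ph k 0) ^+ 2 / p k 0 <= gamma].
Proof.
move=> [p0 p1 pg].
have chi0 k : (0 <= chi2_term (p k 0)%R (ph k 0)%R)%E.
  rewrite /chi2_term; case: ifP => _; first by case: ifP.
  by rewrite lee_fin divr_ge0// sqr_ge0.
have pgt0 k : 0 < p k 0.
  rewrite lt_def p0 andbT; apply/eqP => pk0.
  have : (chi2_term (p k 0)%R (ph k 0)%R <= gamma%:E)%E.
    apply: le_trans pg; rewrite (bigD1 k)//= leeDl// sume_ge0//.
  by rewrite /chi2_term pk0 eqxx gt_eqF ?phat_gt0.
split => //.
  move: p1; rewrite dot_sum => <-; apply: eq_bigr => k _.
  by rewrite mxE mul1r.
rewrite -lee_fin -sumEFin; apply: le_trans pg; apply: lee_sum => k _.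
by rewrite /chi2_term gt_eqF.
Qed.

Lemma weight_setP (p : 'I_K -> R) : (forall k, 0 < p k) -> \sum_k p k = 1 ->
  \sum_k (p k - ph k 0) ^+ 2 / p k <= gamma ->
  weight_set Xi xihat gamma (\col_k p k).
Proof.
move=> p0 p1 pg; split => [k||].
- by rewrite mxE ltW.
- by rewrite dot_sum -[RHS]p1; apply: eq_bigr => k _; rewrite !mxE mul1r.
- rewrite (eq_bigr (fun k => ((p k - ph k 0) ^+ 2 / p k)%:E)) => [|k _].
    by rewrite sumEFin lee_fin.
  by rewrite [(\col__ _) _ _]mxE /chi2_term gt_eqF.
Qed.

(** Weights and conditional measures can be chosen independently, since their mixture lies in the
    ambiguity set. Together with [worst_case_le] this splits the supremum into the inner and outer
    problems. *)
Lemma worst_case_ge (p : 'cV[R]_K) (m : 'I_K -> probability T R) Q :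
  weight_set Xi xihat gamma p -> (forall k, moment_ball Xi xihat eps k (m k)) ->
  ((\sum_k p k 0 * mxdot (Q k) (second_moment (m k)))%:E <=
    worst_case Xi xihat (slice cone) gamma eps Q)%E.
Proof.
move=> wp mb; have [p0 p1 _] := weight_set_gt0 wp.
have mXi k : m k (Xi k) = 1%E by have [] := mb k.
have pge0 k : 0 <= p k 0 by exact: ltW.
have [P PE] := mixture_probability m pge0 p1.
apply: ereal_sup_ubound; exists P.
  split; last by exists p, m; split => // A _; exact: PE.
  rewrite PE -[RHS]/(1%:E) -p1 -sumEFin; apply: eq_bigr => k _.
  by rewrite [m k _](probability_slice (mXi k)) mule1.
rewrite -sumEFin; apply: eq_bigr => k _.
by apply: (@cond_expectation_mixture (fun k => p k 0) m) => // B _; exact: PE.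
Qed.

Lemma worst_case_le Q a :
  (forall (p : 'cV[R]_K) (m : 'I_K -> probability T R),
    weight_set Xi xihat gamma p -> (forall k, moment_ball Xi xihat eps k (m k)) ->
    \sum_k p k 0 * mxdot (Q k) (second_moment (m k)) <= a) ->
  (worst_case Xi xihat (slice cone) gamma eps Q <= a%:E)%E.
Proof.
move=> ha; apply: ge_ereal_sup => _ [P [_ [p [m [wp mb PE]]]] <-].
have [p0 _ _] := weight_set_gt0 wp.
rewrite (eq_bigr (fun k => (p k 0 * mxdot (Q k) (second_moment (m k)))%:E)).
  by rewrite sumEFin lee_fin; exact: ha.
move=> k _; apply: (@cond_expectation_mixture (fun k => p k 0) m) => // j;
  first exact: ltW.
by have [] := mb j.
Qed.

End ambiguity.

(** With [z = s k + eta], squaring the cone constraint gives [r k ^+ 2 <= omega * (omega - z)]: the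
    symmetric 2 by 2 matrix with diagonal [omega - z], [omega] and off-diagonal entry [- r k] is
    positive semidefinite. Evaluating it at [(p k, ph k)], dividing by [p k] and summing yields the
    bound. *)
Lemma chi_square_weak_duality (R : realType) K (ph s r p : 'I_K -> R)
    (gamma eta omega : R) :
  (forall k, 0 < p k) -> \sum_k p k = 1 -> \sum_k ph k = 1 ->
  \sum_k (p k - ph k) ^+ 2 / p k <= gamma -> 0 <= omega ->
  (forall k, s k + eta <= omega /\
    Num.sqrt (4 * r k ^+ 2 + (s k + eta) ^+ 2) <= 2 * omega - s k - eta) ->
  \sum_k p k * s k <=
    gamma * omega - eta - 2 * (\sum_k ph k * r k) + 2 * omega.
Proof.
move=> p0 p1 ph1 pg w0 cons.
have term k : p k * (s k + eta) <=
    omega * ((p k - ph k) ^+ 2 / p k) - 2 * (ph k * r k) + 2 * omega * ph k.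
  have [zw sq] := cons k; set z := s k + eta in zw sq.
  have sqE : 2 * omega - s k - eta = 2 * omega - z by rewrite /z; ring.
  rewrite sqE in sq.
  have z0 : 0 <= 2 * omega - z by apply: le_trans sq; exact: sqrtr_ge0.
  have rr : r k ^+ 2 <= omega * (omega - z).
    have : 4 * r k ^+ 2 + z ^+ 2 <= (2 * omega - z) ^+ 2.
      have h0 : 0 <= 4 * r k ^+ 2 + z ^+ 2.
        by rewrite addr_ge0 ?sqr_ge0// mulr_ge0// sqr_ge0.
      by rewrite -(sqr_sqrtr h0) ler_pXn2r// nnegrE sqrtr_ge0.
    by clearbody z; move=> h; lra.
  have pk0 := p0 k.
  have quad : 0 <= p k ^+ 2 * (omega - z) - 2 * p k * ph k * r k + omega * ph k ^+ 2.
    (* If the first diagonal entry is 0, then [r k] is 0 as well; otherwise multiplying by that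
       entry completes the square. *)
    have [a0|a0] := eqVneq (omega - z) 0.
      have -> : r k = 0.
        apply/eqP; rewrite -sqrf_eq0 eq_le sqr_ge0 andbT.
        by move: rr; rewrite a0 mulr0.
      rewrite a0 !mulr0 subr0 add0r.
      by rewrite mulr_ge0// sqr_ge0.
    have {}a0 : 0 < omega - z by rewrite lt_def a0 subr_ge0.
    rewrite -(pmulr_rge0 _ a0).
    have -> : (omega - z) * (p k ^+ 2 * (omega - z) - 2 * p k * ph k * r k
        + omega * ph k ^+ 2) = ((omega - z) * p k - r k * ph k) ^+ 2
        + (omega * (omega - z) - r k ^+ 2) * ph k ^+ 2 by ring.
    by rewrite addr_ge0 ?sqr_ge0// mulr_ge0 ?sqr_ge0// subr_ge0.
  rewrite -subr_ge0 -(pmulr_rge0 _ pk0).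
  have -> : p k * (omega * ((p k - ph k) ^+ 2 / p k) - 2 * (ph k * r k)
      + 2 * omega * ph k - p k * z) =
    p k ^+ 2 * (omega - z) - 2 * p k * ph k * r k + omega * ph k ^+ 2.
    by field; rewrite gt_eqF.
  exact: quad.
have -> : \sum_k p k * s k = \sum_k p k * (s k + eta) - eta.
  have -> : \sum_k p k * (s k + eta) = \sum_k (p k * s k + p k * eta).
    by apply: eq_bigr => k _; rewrite mulrDr.
  by rewrite big_split/= -mulr_suml p1 mul1r addrK.
have : \sum_k p k * (s k + eta) <= \sum_k (omega * ((p k - ph k) ^+ 2 / p k)
    - 2 * (ph k * r k) + 2 * omega * ph k) by apply: ler_sum => k _.
rewrite big_split/= sumrB -!mulr_sumr ph1.
have := ler_wpM2l w0 pg.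
lra.
Qed.

(** * Weak and strong duality for the moment problem on one cell *)

Section moment_duality.
Context {R : realType} {S K N : nat}.
Variables (cone : set 'cV[R]_S.+1) (zeta : 'I_K -> 'cV[R]_S.+1).
Variables (Xi : 'I_K -> set 'cV[R]_S.+1) (xihat : 'I_N -> 'cV[R]_S.+1).
Variables (eps : 'I_K -> R).
Hypothesis cone_supp : support_cone cone.
Hypothesis Xi_part : voronoi_partition cone zeta Xi.
Hypothesis xihat_supp : forall i, slice cone (xihat i).
Hypothesis sampled : forall k, sample_idx Xi xihat k != finset.set0.
Hypothesis eps_ge0 : forall k, 0 <= eps k.

Local Notation T := (borel_cV R S).
Local Notation Om := (Omegahat Xi xihat).

Lemma cell_second_moment_le k (P : probability T R) Q a : P (Xi k) = 1%E ->
  (forall v, Xi k v -> qform Q v <= a) -> mxdot Q (second_moment P) <= a.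
Proof.
move=> PXi Qa; have [c cb] := slice_bounded cone_supp.
exact: (second_moment_le (slice_measurable cone_supp) cb
  (cell_measurable Xi_part k) (cell_sub Xi_part (k:=k)) PXi Qa).
Qed.

(** With [M] the second moment, [mxdot Q M] is [mxdot (Q^T + B) (M - Om k)] plus the two traces
    minus [mxdot B M]. Cauchy-Schwarz bounds the first term, and the sign condition on the cell
    bounds the last by [alpha]. *)
Lemma moment_weak_duality k P (Q B : 'M[R]_S.+1) alpha :
  moment_ball Xi xihat eps k P -> B^T = B ->
  (forall v, Xi k v -> 0 <= qform B v + alpha) ->
  mxdot Q (second_moment P) <= alpha + \tr (Q *m Om k) + \tr (B *m Om k)
    + eps k * frobenius (Q^T + B).
Proof.
move=> /(moment_ballP eps cone_supp Xi_part xihat_supp sampled) [PXi PO] BT Ba.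
have hB : mxdot (- B) (second_moment P) <= alpha.
  apply: cell_second_moment_le PXi _ => v /Ba; rewrite qformN; lra.
rewrite !mxtrace_mxdot BT; set M := second_moment P.
have -> : mxdot Q M = mxdot Q^T M.
  by rewrite -mxdot_tr [M^T]second_moment_sym.
have := mxdot_cauchy_schwarz (Q^T + B) (M - Om k).
have := ler_wpM2l (frobenius_ge0 (Q^T + B)) PO.
move: hB; rewrite mxdotNl mxdotDl !mxdotDr !mxdotNr -/M; lra.
Qed.

Lemma moment_strong_duality k (Q : 'M[R]_S.+1) V V' : Q^T = Q ->
  (forall P, moment_ball Xi xihat eps k P -> mxdot Q (second_moment P) <= V) ->
  V < V' ->
  exists (B : 'M[R]_S.+1) (alpha : R), [/\ B^T = B,
    forall v, Xi k v -> 0 <= qform B v + alpha &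
    alpha + \tr (Q *m Om k) + \tr (B *m Om k) + eps k * frobenius (Q^T + B) <= V'].
Proof.
move=> QT QV VV'.
have [P0 P0ball P0Om] :=
  empirical_ball cone_supp Xi_part xihat_supp sampled eps_ge0 k.
have [P0Xi _] := P0ball.
have [e0|e0] := eqVneq (eps k) 0.
  (* The left-hand side is then the objective at [Om k], which the empirical measure keeps at most
     [V]. *)
  exists 0, 0; split; first exact: trmx0.
    by move=> v _; rewrite addr0 /qform mulmx0 mul0mx mxE.
  rewrite e0 mul0r mul0mx mxtrace0 !addr0 add0r mxtrace_mxdot QT -P0Om.
  by apply: le_trans (QV _ P0ball) _; exact: ltW.
have {}e0 : 0 < eps k by rewrite lt_def e0 eps_ge0.
pose C : set 'M[R]_S.+1 :=
  [set second_moment P | P in [set P : probability T R | P (Xi k) = 1%E]].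
have [c cb] := slice_bounded cone_supp.
have mD := slice_measurable cone_supp.
have sliceP := probability_slice cone_supp Xi_part (k:=k).
have COm : C (Om k) by rewrite -P0Om; exists P0.
have Csym M : C M -> M^T = M by move=> [P _ <-]; exact: second_moment_sym.
have Ccvx M M' t : C M -> C M' -> 0 <= t <= 1 -> C ((1 - t) *: M + t *: M').
  move=> [P PXi <-] [P' PXi' <-] /andP[t0 t1].
  pose p (i : 'I_2) := if i == ord0 then 1 - t else t.
  pose m (i : 'I_2) := if i == ord0 then P else P'.
  have p0 i : 0 <= p i by rewrite /p; case: ifP => // _; rewrite subr_ge0.
  have p1 : \sum_i p i = 1 by rewrite !big_ord_recl big_ord0/= /p/= addr0 subrK.
  have mXi i : m i (Xi k) = 1%E by rewrite /m; case: ifP.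
  have [P1 P1E] := mixture_probability m p0 p1.
  have P1Xi : P1 (Xi k) = 1%E.
    rewrite P1E -[RHS]/(1%:E) -p1 -sumEFin; apply: eq_bigr => i _.
    by rewrite mXi mule1.
  exists P1 => //.
  rewrite (second_moment_mixture mD cb p0 P1E (sliceP _ P1Xi)).
    by rewrite !big_ord_recl big_ord0/= /p /m/= addr0.
  by move=> i; exact: sliceP (mXi i).
have Cbnd M : C M -> frobenius M <= c.
  move=> [P PXi <-]; exact: (frobenius_second_moment_le mD cb (sliceP _ PXi)).
have CV M : C M -> frobenius (M - Om k) <= eps k -> mxdot Q M <= V.
  move=> [P PXi <-] PO; apply: QV.
  exact/(moment_ballP eps cone_supp Xi_part xihat_supp sampled).
have [Z [ZT ZC]] := ball_duality e0 COm VV' Csym Ccvx Cbnd CV.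
(* Here [Q^T + B] is [- Z], and this [alpha] makes the dual objective equal to [V']. The inequality
   on the cell is the separation evaluated at Dirac measures. *)
exists (- (Q + Z)), (V' + mxdot Z (Om k) - eps k * frobenius Z); split.
- by rewrite linearN/= linearD/= QT ZT.
- move=> v Xv; have Cv : C ((v : 'cV_S.+1) *m v^T).
    exists (\d_(v : T) : probability T R); last exact: second_moment_dirac.
    by rewrite /= diracE mem_set.
  by have := ZC _ Cv; rewrite qformN qform_mxdot; lra.
- rewrite !mxtrace_mxdot linearN/= linearD/= QT ZT.
  have -> : Q - (Q + Z) = - Z by rewrite opprD addrA subrr add0r.
  rewrite frobeniusN mxdotNl mxdotDl; lra.
Qed.

End moment_duality.

(** * Recourse constraints as quadratic forms on the slice *)

Section recourse_constraints.
Context {R : realType} {S N1 N2 L : nat}.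
Variables (D : 'M[R]_(N2, S.+1)) (W : 'I_L -> 'M[R]_(N2, S.+1)).
Variable (T : 'I_L -> 'cV[R]_N1 -> 'cV[R]_S.+1).
Implicit Types (Y : 'M[R]_(N2, S.+1)) (Q : 'M[R]_S.+1) (v : 'cV[R]_S.+1).

Lemma qform_ee_last v : dot (e_last S) v = 1 -> qform (ee_last : 'M[R]_S.+1) v = 1.
Proof. by move=> v1; rewrite /ee_last qform_outer v1 mulr1. Qed.

Lemma ee_last_sym : (ee_last : 'M[R]_S.+1)^T = ee_last.
Proof. by rewrite /ee_last trmx_mul trmxK. Qed.

Lemma Delta_mx_sym l x Y Q : (Delta_mx D W T l x Y Q)^T = Delta_mx D W T l x Y Q.
Proof.
rewrite /Delta_mx; set A := calW D W l; set t := calT T l x.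
rewrite linearZ/= !linearB/= !linearD/= !linearZ/= !trmx_mul !trmxK.
move: (A^T *m Y) (Y^T *m A) (lam l *: Q) (lam l *: Q^T) (t *m _) (_ *m t^T).
by move=> a b c d e f; apply/matrixP => i j; rewrite !mxE; ring.
Qed.

Lemma qform_Delta_mx l x Y Q v : dot (e_last S) v = 1 ->
  qform (Delta_mx D W T l x Y Q) v =
  dot (calW D W l *m v) (Y *m v) + lam l * qform Q v - dot (calT T l x) v.
Proof.
move=> v1; rewrite /Delta_mx qformZ !qformD !qformN !qformZ qform_tr.
rewrite !qform_outer !qform_mul v1 (dotC (Y *m v)); lra.
Qed.

(** [Q] enters only through [Q + Q^T], so the dual certificate may use its symmetric part without
    touching the recourse constraints. *)
Lemma Delta_mx_symmetrize l x Y Q :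
  Delta_mx D W T l x Y (2^-1 *: (Q + Q^T)) = Delta_mx D W T l x Y Q.
Proof.
congr (2^-1 *: (_ - _ - _)); rewrite -!addrA; congr (_ + (_ + _)).
apply/matrixP => i j; rewrite !mxE; lra.
Qed.

End recourse_constraints.

(** * Equality of the two optimal values *)

Section equivalence.
Context {R : realType} {S N1 N2 L K N : nat}.
Variables (cone : set 'cV[R]_S.+1) (zeta : 'I_K -> 'cV[R]_S.+1).
Variables (Xi : 'I_K -> set 'cV[R]_S.+1) (xihat : 'I_N -> 'cV[R]_S.+1).
Variables (gamma : R) (eps : 'I_K -> R).
Variables (X : set 'cV[R]_N1) (c : 'cV[R]_N1) (delta : R).
Variables (D : 'M[R]_(N2, S.+1)) (W : 'I_L -> 'M[R]_(N2, S.+1)).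
Variable (T : 'I_L -> 'cV[R]_N1 -> 'cV[R]_S.+1).
Hypothesis cone_supp : support_cone cone.
Hypothesis Xi_part : voronoi_partition cone zeta Xi.
Hypothesis xihat_supp : forall i, slice cone (xihat i).
Hypothesis sampled : forall k, sample_idx Xi xihat k != finset.set0.
Hypothesis gamma_ge0 : 0 <= gamma.
Hypothesis eps_ge0 : forall k, 0 <= eps k.
Hypothesis delta_gt0 : 0 < delta.

Local Notation prob := (probability (borel_cV R S) R).
Local Notation worst Q := (worst_case Xi xihat (slice cone) gamma eps Q).

Lemma dot_phat (r : 'cV[R]_K) :
  dot (phat Xi xihat) r = \sum_k phat Xi xihat k 0 * r k 0.
Proof. exact: dot_sum. Qed.

Lemma dot_phat_ones : dot (phat Xi xihat) (ones K) = 1.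
Proof.
rewrite dot_phat -(phat_sum1 cone_supp Xi_part xihat_supp sampled).
by apply: eq_bigr => k _; rewrite [ones K _ _]mxE mulr1.
Qed.

Lemma cell_e_last k v : Xi k v -> dot (e_last S) v = 1.
Proof. by move=> /(cell_sub Xi_part) []. Qed.

Lemma cell_voronoi k v : Xi k v -> voronoi_cone cone zeta k v.
Proof.
have [_ _ _ clXi] := Xi_part; move=> /(@subset_closure _ (Xi k)).
by rewrite clXi => -[].
Qed.

(** Weak duality at both levels: a copositive solution keeps its [x], [theta], [Y], [Q], its [s k]
    dominates the inner problem on each cell, and [eta], [omega], [r] bound the outer one. *)
Lemma PDR_le_cop :
  (PDR_value cone Xi xihat gamma eps X c delta D W T <=
   cop_value cone zeta Xi xihat gamma eps X c delta D W T)%E.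
Proof.
apply: le_ereal_inf_tmp => _ [x [theta [et [omega [r [s [alpha [ppi [Y [Q [B
  [[Xx w0 BT cons] ->]]]]]]]]]]]].
apply: (@le_trans _ _ (PDR_objective cone Xi xihat gamma eps c delta x theta Q)).
  apply: ereal_inf_lbound; exists x, theta, Y, Q; split => //; split => //.
  move=> k l xi Xxi; have xi1 := cell_e_last Xxi.
  have [_ _ /(_ l)[pk [_ cop]] _] := cons k.
  have := cop _ (cell_voronoi Xxi).
  by rewrite qformD qformN qformZ qform_Delta_mx// qform_ee_last//; lra.
rewrite /PDR_objective /cop_objective [leRHS]EFinD leeD2l// EFinM.
apply: lee_wpmul2l; first by rewrite lee_fin invr_ge0 ltW.
apply: (worst_case_le cone_supp Xi_part sampled) => p m wp mb.
have [p0 p1 pg] := weight_set_gt0 cone_supp Xi_part sampled wp.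
have ms k : mxdot (Q k) (second_moment (m k)) <= s k 0.
  have [_ le_s _ [_ copB]] := cons k; apply: le_trans le_s.
  apply: (moment_weak_duality cone_supp Xi_part xihat_supp sampled) => //.
  move=> v Xv; have := copB _ (cell_voronoi Xv).
  by rewrite qformD qformZ qform_ee_last ?mulr1// (cell_e_last Xv).
apply: (@le_trans _ _ (\sum_k p k 0 * s k 0)).
  by apply: ler_sum => k _; rewrite ler_pM2l.
rewrite dot_phat_ones mulr1 dot_phat.
apply: chi_square_weak_duality => //.
  exact: (phat_sum1 cone_supp Xi_part xihat_supp sampled).
by move=> k; have [] := cons k.
Qed.

(** When the worst case is finite, strong duality on every cell and then over the weights gives, for
    each [e], a copositive solution whose value is within [e]. *)
Lemma cop_le_PDR_objective x theta Y Q :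
  PDR_feasible Xi X D W T x theta Y Q ->
  (cop_value cone zeta Xi xihat gamma eps X c delta D W T <=
   PDR_objective cone Xi xihat gamma eps c delta x theta Q)%E.
Proof.
move=> [Xx feas]; rewrite /PDR_objective.
have phat0 := phat_gt0 cone_supp Xi_part sampled.
have phat1 := phat_sum1 cone_supp Xi_part xihat_supp sampled.
have worst_ge p m := worst_case_ge cone_supp Xi_part sampled (gamma := gamma)
  (eps := eps) (p := p) (m := m) Q.
have [m0 m0ball] : {m0 : 'I_K -> prob & forall k, moment_ball Xi xihat eps k (m0 k)}.
  apply: choice => k; have [P Pb _] := empirical_ball cone_supp Xi_part
    xihat_supp sampled eps_ge0 k; by exists P.
have phat_weight : weight_set Xi xihat gamma (\col_k phat Xi xihat k 0).
  apply: weight_setP => //; rewrite big1// => k _.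
  by rewrite subrr expr0n/= mul0r.
(* The nominal weights with any measures from the balls bound the worst case below by a real number,
   which excludes -oo. *)
have := worst_ge _ _ phat_weight m0ball.
case VE : (worst Q) => [V||]; last by [].
  move=> _; rewrite -EFinM -EFinD; apply/lee_addgt0Pr => e e0.
  have {}worst_ge p m : weight_set Xi xihat gamma p ->
      (forall k, moment_ball Xi xihat eps k (m k)) ->
      \sum_k p k 0 * mxdot (Q k) (second_moment (m k)) <= V.
    by move=> wp mb; have := worst_ge p m wp mb; rewrite VE lee_fin.
  (* One [e1] is spent in [s], one on near-optimal measures and one in [chi_square_duality]; the
     factor [delta^-1] turns the three into [e]. *)
  pose e1 := delta * e / 3.
  have e10 : 0 < e1 by rewrite divr_gt0// mulr_gt0.
  pose Q' k := 2^-1 *: (Q k + (Q k)^T).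
  have Q'T k : (Q' k)^T = Q' k by apply/matrixP => i j; rewrite !mxE addrC.
  have Q'E k (P : prob) :
      mxdot (Q' k) (second_moment P) = mxdot (Q k) (second_moment P).
    have tr : mxdot (Q k)^T (second_moment P) = mxdot (Q k) (second_moment P).
      by rewrite -mxdot_tr trmxK second_moment_sym.
    by rewrite /Q' mxdotZl mxdotDl tr; lra.
  have [b bP] := slice_bounded cone_supp.
  pose vals k := [set mxdot (Q k) (second_moment P) | P in
    [set P : prob | moment_ball Xi xihat eps k P]].
  have supv k : has_sup (vals k).
    split.
      by exists (mxdot (Q k) (second_moment (m0 k))); exists (m0 k) => //; exact: m0ball.
    exists (frobenius (Q k) * b) => _ [P [PXi _] <-].
    apply: (cell_second_moment_le cone_supp Xi_part PXi) => v Xv.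
    apply: le_trans (ler_norm _) (le_trans (qform_le _ _) _).
    by rewrite ler_wpM2l ?frobenius_ge0// bP//; exact: cell_sub Xi_part _ _ Xv.
  pose s k := sup (vals k) + e1.
  have dual k : exists u : 'M[R]_S.+1 * R, [/\ u.1^T = u.1,
      forall v, Xi k v -> 0 <= qform u.1 v + u.2 &
      u.2 + \tr (Q' k *m Omegahat Xi xihat k) + \tr (u.1 *m Omegahat Xi xihat k)
        + eps k * frobenius ((Q' k)^T + u.1) <= s k].
    have [P Pb||B [al Bal]] := moment_strong_duality cone_supp Xi_part xihat_supp
      sampled eps_ge0 (k := k) (V := sup (vals k)) (V' := s k) (Q'T k); last first.
    - by exists (B, al).
    - by rewrite ltrDl.
    - by rewrite Q'E; apply: ub_le_sup; [exact: (supv k).2|exists P].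
  have [u uspec] := choice dual.
  have weak (p : 'I_K -> R) : (forall k, 0 < p k) -> \sum_k p k = 1 ->
      \sum_k (p k - phat Xi xihat k 0) ^+ 2 / p k <= gamma ->
      \sum_k p k * s k <= V + 2 * e1.
    move=> p0 p1 pg.
    have near_opt k : exists P : prob, moment_ball Xi xihat eps k P
        /\ sup (vals k) - e1 < mxdot (Q k) (second_moment P).
      by have [_ [P Pb <-] lt] := sup_adherent e10 (supv k); exists P.
    have [m mspec] := choice near_opt.
    have := worst_ge _ m (weight_setP p0 p1 pg) (fun k => (mspec k).1).
    have : \sum_k p k * s k <= \sum_k (p k * mxdot (Q k) (second_moment (m k))
        + p k * (2 * e1)).
      apply: ler_sum => k _; rewrite -mulrDr ler_pM2l// /s.
      by have := (mspec k).2; lra.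
    rewrite big_split/= -mulr_suml p1 mul1r.
    under [X in _ -> X <= _ -> _]eq_bigr do rewrite mxE.
    by lra.
  have [et [omega [r [w0 cons obj]]]] :=
    chi_square_duality phat0 phat1 gamma_ge0 weak e10.
  apply: (@le_trans _ _ (cop_objective Xi xihat gamma c delta x theta et omega
    (\col_k r k))%:E).
    (* Taking [ppi] equal to [- (kap l * theta)] makes its sign constraint tight, and copositivity
       then restates the decision-rule constraint on the cell. *)
    apply: ereal_inf_lbound; exists x, theta, et, omega, (\col_k r k), (\col_k s k),
      (\col_k (u k).2), (fun k => \col_l - (kap l * theta)), Y, Q',
      (fun k => (u k).1); split => //.
    split => // [k|k]; first by have [] := uspec k.
    have [BT Ba Bs] := uspec k; have [cons1 cons2] := cons k.
    split; rewrite ?mxE//.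
      move=> l; rewrite mxE addNr lexx; split=> //.
      apply: (copositive_voronoi_cone cone_supp Xi_part).
        by rewrite linearB/= Delta_mx_sym linearZ/= ee_last_sym.
      move=> v Xv; have v1 := cell_e_last Xv.
      rewrite Delta_mx_symmetrize qformD qformN qformZ qform_Delta_mx//.
      by rewrite qform_ee_last//; have := feas k l v Xv; lra.
    apply: (copositive_voronoi_cone cone_supp Xi_part).
      by rewrite linearD/= linearZ/= ee_last_sym BT.
    move=> v Xv; rewrite qformD qformZ qform_ee_last ?mulr1 ?(cell_e_last Xv)//.
    exact: Ba.
  rewrite -EFinD lee_fin /cop_objective dot_phat_ones mulr1 dot_phat.
  under eq_bigr do rewrite mxE.
  have -> : dot c x + theta + delta^-1 * V + e
    = dot c x + theta + delta^-1 * (V + 3 * e1).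
    by rewrite /e1; field; rewrite gt_eqF.
  rewrite lerD2l ler_pM2l ?invr_gt0//.
  by apply: (le_trans obj); lra.
by move=> _; rewrite gt0_muley ?lte_fin ?invr_gt0// addey// leey.
Qed.

End equivalence.

Theorem theorem1 (R : realType) (S N1 N2 L K N : nat)
  (cone : set 'cV[R]_S.+1) (zeta : 'I_K -> 'cV[R]_S.+1)
  (Xi : 'I_K -> set 'cV[R]_S.+1) (xihat : 'I_N -> 'cV[R]_S.+1)
  (gamma : R) (eps : 'I_K -> R)
  (X : set 'cV[R]_N1) (c : 'cV[R]_N1) (delta : R)
  (D : 'M[R]_(N2, S.+1)) (W : 'I_L -> 'M[R]_(N2, S.+1))
  (T : 'I_L -> 'cV[R]_N1 -> 'cV[R]_S.+1)
  (cone_supp : support_cone cone)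
  (Xi_part : voronoi_partition cone zeta Xi)
  (xihat_supp : forall i, slice cone (xihat i))
  (sampled : forall k, sample_idx Xi xihat k != finset.set0)
  (gamma_ge0 : 0 <= gamma) (eps_ge0 : forall k, 0 <= eps k)
  (delta_gt0 : 0 < delta) (delta_lt1 : delta < 1)
  (T_affine : forall l, is_affine (T l)) :
  PDR_value cone Xi xihat gamma eps X c delta D W T =
  cop_value cone zeta Xi xihat gamma eps X c delta D W T.
Proof.
apply/eqP; rewrite eq_le; apply/andP; split; first exact: PDR_le_cop.
apply: le_ereal_inf_tmp => _ [x [theta [Y [Q [feas ->]]]]].
exact: cop_le_PDR_objective feas.
Qed.
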